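(* Let $q$ be a power of a prime $p$, let $u\ge 1$ be an integer and put $m=p^{u-1}$. Let $a_1,a_2,a_3$ be distinct elements of $\mathbb{F}_q$. Let $F_1=\mathbb{F}_q(x,y_1)$ and $F_2=\mathbb{F}_q(x,y_2)$ be the function fields defined by the equations $$\mathrm{Tr}_{p^u/p}(y_1)=\frac{(x-a_1)(x-a_2)}{x-a_3}\qquad\text{and}\qquad \mathrm{Tr}_{p^u/p}(y_2)=\frac{x-a_3}{(x-a_1)(x-a_2)},$$ respectively, where $\mathrm{Tr}_{p^u/p}(y)=y^{p^{u-1}}+y^{p^{u-2}}+\cdots+y^p+y$. Then both $F_1/\mathbb{F}_q$ and $F_2/\mathbb{F}_q$ are $m$-friendly algebraic function fields.
   Context: Here $v_P$ is the normalized discrete valuation at a place $P$ of a function field, $(z)_\infty$ is the pole divisor of $z$, and $g(F)$ is the genus of $F$. Definition. An $m$-friendly algebraic function field is a function field $F/\mathbb{F}_q$ with a place $Q$ such that: (1) $g(F)=m-1$; (2) there exists $z_1\in F$ with $v_Q(z_1)=1$ and $\deg((z_1)_\infty)=2$. *)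

(* Defs.v *)
From HB Require Import structures.
From mathcomp Require Import all_boot all_order all_algebra.
From mathcomp Require Import boolp classical_sets cardinality fsbigop.

Set Implicit Arguments.
Unset Strict Implicit.
Unset Printing Implicit Defensive.

Import Order.TTheory GRing.Theory Num.Theory.

Local Open Scope classical_set_scope.
Local Open Scope ring_scope.

(* An extension F / K is given by the embedding iota of K in F: F is of
   infinite dimension over K, hence not a fieldExtType. The definitions follow
   Stichtenoth, "Algebraic Function Fields and Codes", Chapter 1. *)

(* The subfield K(S) of F; since 0^-1 = 0, divring_closed means "subfield". *)
Definition adjoin (K F : fieldType) (iota : {rmorphism K -> F}) (S : set F) :
    set F :=
  [set z | forall L : {pred F}, divring_closed L ->
     (forall c, iota c \in L) -> S `<=` [set` L] -> z \in L].

Definition transcendental (K F : fieldType) (iota : {rmorphism K -> F})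
    (x : F) : Prop :=
  ~ algebraicOver iota x.

(* Function fields in one variable, with K as full constant field. *)
Definition function_field (K F : fieldType) (iota : {rmorphism K -> F}) :
    Prop :=
  (exists2 x : F, transcendental iota x &
     exists n (b : 'I_n -> F), forall z, exists2 c : 'I_n -> F,
       (forall i, adjoin iota [set x] (c i)) & z = \sum_i c i * b i) /\
  (forall z, algebraicOver iota z -> exists c, z = iota c).

(* A place is represented by its valuation ring, which determines it. *)
Record place (K F : fieldType) (iota : {rmorphism K -> F}) := Place {
  vring : {pred F};
  vring_subring : subring_closed vring;
  vring_const : forall c, iota c \in vring;
  vring_const_proper : exists2 z, z \in vring & forall c, z != iota c;
  vring_proper : exists z, z \notin vring;
  vring_total : forall z, (z \in vring) || (z^-1 \in vring) }.

HB.instance Definition _ (K F : fieldType) (iota : {rmorphism K -> F}) :=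
  gen_eqMixin (place iota).
HB.instance Definition _ (K F : fieldType) (iota : {rmorphism K -> F}) :=
  gen_choiceMixin (place iota).

Section Places.
Variables (K F : fieldType) (iota : {rmorphism K -> F}).
Implicit Types (P : place iota) (D : place iota -> int) (U W : set F).

Definition vunit P : {pred F} :=
  [pred z | [&& z != 0, z \in vring P & z^-1 \in vring P]].

Definition videal P : {pred F} :=
  [pred z | (z \in vring P) && (z \notin vunit P)].

Definition prime_element P (t : F) : Prop :=
  forall z, z \in videal P <-> exists2 w, w \in vring P & z = t * w.

(* The normalized discrete valuation v_P. In a function field, the integer n
   exists and is unique for all z != 0; by convention valuation P 0 = 0, so
   the value v_P(0) = +oo has to be dealt with separately. *)
Definition valuation P (z : F) : int :=
  xget 0 [set n : int | exists t w,
    [/\ prime_element P t, w \in vunit P & z = t ^ n * w]].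

(* The classes modulo W of the b i form a K-basis of U / W. *)
Definition basis_mod U W n (b : 'I_n -> F) : Prop :=
  [/\ forall i, U (b i),
      forall c : 'I_n -> K, W (\sum_i iota (c i) * b i) -> forall i, c i = 0 &
      forall z, U z -> exists c : 'I_n -> K, W (z - \sum_i iota (c i) * b i)].

(* dim_K (U / W), or 0 if that dimension is infinite; in a function field the
   dimensions used below are all finite. *)
Definition dim_mod U W : nat :=
  xget 0%N [set n | exists b : 'I_n -> F, basis_mod U W b].

Definition place_deg P : nat := dim_mod [set` vring P] [set` videal P].

Definition divisor D : Prop := finite_set [set P | D P != 0].

Definition divisor_deg D : int :=
  \sum_(P \in [set: place iota]) D P * (place_deg P)%:Z.

Definition pole_divisor (z : F) : place iota -> int :=
  fun P => Num.max 0 (- valuation P z).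

Definition RR_space D : set F :=
  [set z | z = 0 \/ forall P, - D P <= valuation P z].

Definition RR_dim D : nat := dim_mod (RR_space D) [set 0].

(* g is the maximum of deg A - l(A) + 1 over all divisors A; a relation, so
   that the existence of this maximum is part of the assertion. *)
Definition has_genus (g : int) : Prop :=
  (exists2 A, divisor A & divisor_deg A - (RR_dim A)%:Z + 1 = g) /\
  (forall A, divisor A -> divisor_deg A - (RR_dim A)%:Z + 1 <= g).

End Places.

Arguments pole_divisor {K F} iota z P.

Definition m_friendly (m : nat) (K : finFieldType) (F : fieldType)
    (iota : {rmorphism K -> F}) : Prop :=
  function_field iota /\
  exists Q : place iota,
    has_genus iota (m%:Z - 1) /\
    exists z1 : F,
      valuation Q z1 = 1 /\ divisor_deg (pole_divisor iota z1) = 2.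

(* Tr_{p^u/p}(y) = y + y^p + ... + y^(p^(u-1)). *)
Definition trace_poly (F : fieldType) (p u : nat) (y : F) : F :=
  \sum_(i < u) y ^+ (p ^ i).

(* Main.v *)
(* Put T(y) = Tr(y). A Moebius transformation brings both defining equations to
   the form x + c / x = A(y) with A = T - b and c <> 0, so that F = K(y)(x) is a
   quadratic extension of K(y). Since A' = 1, the order K[y] + K[y] x is
   integrally closed, and looking at the two poles of y shows that
   L(n (y)_oo) consists of the a(y) + b(y) x with deg a <= n and
   deg b <= n - m. Every divisor is bounded by some n (y)_oo + (h(y))_0, and
   deg (h(y))_0 <= 2 deg h by weak approximation; together with the dimension
   of L(n (y)_oo) this gives Riemann's inequality with g = m - 1, and equality
   for the divisor m (y)_oo. Finally y has exactly two poles, both simple and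
   rational, so z1 = 1 / y has a simple zero and a pole divisor of degree 2. *)
Require Import Defs.
From HB Require Import structures.
From Stdlib Require Import Ring.
From mathcomp Require Import all_boot all_order all_algebra.
From mathcomp Require Import boolp classical_sets cardinality fsbigop.
From mathcomp Require Import zify.

Set Implicit Arguments.
Unset Strict Implicit.
Unset Printing Implicit Defensive.

Import Order.TTheory GRing.Theory Num.Theory.

Local Open Scope classical_set_scope.
Local Open Scope ring_scope.

(** A place is only a valuation ring, so discreteness, finite residue degrees and approximation have
    to be derived. One count serves throughout: F has degree at most 2 over K(Y) for Y = y or 1 / y,
    so more than 2 deg h elements satisfy a relation over K[h(Y)], and cancelling powers of h(Y)
    gives one that survives modulo h(Y). This bounds chains of ideals, residue degrees and zeros of
    h(Y). The shape x + c / x is chosen for its symmetry: at one pole of y it is x that has the pole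
    of order m, at the other c / x. Hence a(y) and b(y) x cannot cancel at both poles, and b pays m
    extra degrees. The dimension (n + 1) + (n + 1 - m) against the degree 2n is what produces g = m
    - 1. Integral closedness is tested one irreducible p at a time. If r / p is integral, p divides
    the trace of r and p^2 its norm; so r is a singular zero of the norm form modulo p, which the
    derivative in y excludes in every characteristic, 2 included. *)

(* The ring tactic of the standard library looks up ring structures up to
   syntactic equality of the carrier, which the canonical instances of MathComp
   defeat; goals are therefore restated with the operations below. *)
Section RingTactic.
Variable R : comNzRingType.
Definition rcar : Type := R.
Definition rzero : rcar := 0 : R.
Definition rone : rcar := 1 : R.
Definition radd (a b : rcar) : rcar := (a : R) + (b : R).
Definition rmul (a b : rcar) : rcar := (a : R) * (b : R).
Definition ropp (a : rcar) : rcar := - (a : R).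
Definition rsub (a b : rcar) : rcar := (a : R) - (b : R).

Lemma ring_theory_of : @ring_theory rcar rzero rone radd rmul rsub ropp eq.
Proof.
by split; [exact: add0r | exact: addrC | exact: addrA | exact: mul1r |
  exact: mulrC | exact: mulrA | exact: mulrDl | | exact: subrr].
Qed.
End RingTactic.

Ltac quote_ring R t := lazymatch t with
  | ?a + - ?b => let a' := quote_ring R a in let b' := quote_ring R b in
                 constr:(@rsub R a' b')
  | ?a + ?b => let a' := quote_ring R a in let b' := quote_ring R b in
               constr:(@radd R a' b')
  | ?a * ?b => let a' := quote_ring R a in let b' := quote_ring R b in
               constr:(@rmul R a' b')
  | - ?b => let b' := quote_ring R b in constr:(@ropp R b')
  | 0 => constr:(@rzero R)
  | 1 => constr:(@rone R)
  | _ => constr:(t : rcar R)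
  end.

Ltac cring R := rewrite ?(expr2, mulr2n);
  match goal with |- @eq _ ?a ?b =>
    let a' := quote_ring R a in let b' := quote_ring R b in
    change (@eq (rcar R) a' b'); ring
  end.

(** * Dimensions of quotients of K-subspaces of F *)

Section Dimension.
Variables (K F : fieldType) (iota : {rmorphism K -> F}).
Implicit Types U V W : set F.

Definition subspace U : Prop :=
  U 0 /\ forall c a b, U a -> U b -> U (iota c * a + b).

Definition comb n (c : 'I_n -> K) (b : 'I_n -> F) : F :=
  \sum_i iota (c i) * b i.

Definition indep_mod W n (b : 'I_n -> F) : Prop :=
  forall c, W (comb c b) -> forall i, c i = 0.

Definition has_dim U W n : Prop := exists b : 'I_n -> F, basis_mod iota U W b.

Lemma subspaceD U a b : subspace U -> U a -> U b -> U (a + b).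
Proof. by case=> _ h Ua Ub; rewrite -[a]mul1r -(rmorph1 iota); apply: h. Qed.

Lemma subspaceZ U c a : subspace U -> U a -> U (iota c * a).
Proof. by case=> U0 h Ua; rewrite -[_ * _]addr0; apply: h. Qed.

Lemma subspaceN U a : subspace U -> U a -> U (- a).
Proof. by move=> sU /(subspaceZ (-1) sU); rewrite rmorphN1 mulN1r. Qed.

Lemma subspaceB U a b : subspace U -> U a -> U b -> U (a - b).
Proof. by move=> sU Ua Ub; apply: subspaceD => //; apply: subspaceN. Qed.

Lemma subspace_sum U (I : Type) (r : seq I) (G : I -> F) :
  subspace U -> (forall i, U (G i)) -> U (\sum_(i <- r) G i).
Proof.
move=> sU UG; elim/big_ind: _ => //; first by case: sU.
by move=> a b; apply: subspaceD.
Qed.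

Lemma subspace_comb U n (c : 'I_n -> K) b :
  subspace U -> (forall i, U (b i)) -> U (comb c b).
Proof. by move=> sU Ub; apply: subspace_sum => // i; apply: subspaceZ. Qed.

Lemma subspace_trans U a b : subspace U -> U (a - b) -> U b -> U a.
Proof. by move=> sU h Ub; rewrite -(subrK b a); apply: subspaceD. Qed.

(** Steinitz bound: the coordinates of the [f i] modulo [W] form a k by n matrix, and for n < k a
    nonzero row of its left kernel is a dependence. *)
Lemma indep_mod_le U W n k (b : 'I_n -> F) (f : 'I_k -> F) :
  subspace W -> basis_mod iota U W b -> (forall i, U (f i)) ->
  indep_mod W f -> (k <= n)%N.
Proof.
move=> sW [Ub _ gen] Uf indf; rewrite leqNgt; apply/negP => ltnk.
pose M := \matrix_(i < k, j < n) (sval (cid (gen _ (Uf i))) j).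
have [i nzi] : exists i, row i (kermx M) != 0.
  apply/existsP; apply: contraLR ltnk; rewrite negb_exists => /forallP h.
  have kM0 : kermx M = 0 by apply/row_matrixP => i; rewrite row0;
    have := h i; rewrite negbK => /eqP.
  have := mxrank_ker M; rewrite kM0 mxrank0 => /esym/eqP; rewrite subn_eq0.
  by move=> h'; rewrite -leqNgt (leq_trans h' (rank_leq_col M)).
case/negP: nzi; apply/eqP/rowP => j; rewrite [RHS]mxE.
pose v := row i (kermx M); apply: (indf (fun j => v 0 j)).
have vM : v *m M = 0 by rewrite /v -row_mul mulmx_ker row0.
have -> : comb (v 0) f =
  \sum_j iota (v 0 j) * (f j - comb (fun l => M j l) b).
  rewrite -[LHS]subr0; under eq_bigr do rewrite mulrBr.
  rewrite sumrB; congr (_ - _).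
  under eq_bigr do rewrite mulr_sumr.
  rewrite exchange_big big1 //= => l _.
  under eq_bigr do rewrite mulrA -rmorphM.
  rewrite -mulr_suml -rmorph_sum /=; have /matrixP/(_ 0 l) := vM.
  by rewrite !mxE => ->; rewrite rmorph0 mul0r.
apply: subspace_sum => // l; apply: subspaceZ => //.
have := svalP (cid (gen _ (Uf l))).
by congr (W (_ - _)); apply: eq_bigr => s _; rewrite mxE.
Qed.

Lemma has_dim_uniq U W n k :
  subspace W -> has_dim U W n -> has_dim U W k -> n = k.
Proof.
move=> sW [b hb] [f hf]; apply/eqP; rewrite eqn_leq.
have [Ub ib _] := hb; have [Uf i_f _] := hf.
by rewrite (indep_mod_le sW hf Ub ib) (indep_mod_le sW hb Uf i_f).
Qed.

Lemma dim_modE U W n : subspace W -> has_dim U W n -> dim_mod iota U W = n.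
Proof.
by move=> sW h; apply: xget_unique => // k hk; apply: (has_dim_uniq sW hk h).
Qed.

(** An independent family of maximal length is a basis, and the bound guarantees that one exists. *)
Lemma has_dim_le U W N : subspace W ->
  (forall k (f : 'I_k -> F), (forall i, U (f i)) -> indep_mod W f ->
     (k <= N)%N) ->
  exists2 n, (n <= N)%N & has_dim U W n.
Proof.
move=> sW bound.
pose ok k := `[< exists2 f : 'I_k -> F, (forall i, U (f i)) & indep_mod W f >].
have ok0 : ok 0%N.
  by apply/asboolP; exists (fun=> 0) => [[]//|c _ []].
have okN k : ok k -> (k <= N)%N by move/asboolP=> [f]; apply: bound.
case: (ex_maxnP (ex_intro (fun k => ok k) _ ok0) okN) => n okn maxn.
exists n; first exact: okN.
case/asboolP: (okn) => b Ub ib; exists b; split=> // z Uz.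
case: (EM (exists c, W (z - comb c b))) => // noc.
have : ok n.+1.
  apply/asboolP; exists (fun i => oapp b z (unlift ord0 i)).
    by move=> i; case: unliftP => /=.
  move=> c; rewrite /comb big_ord_recl unlift_none /=.
  under eq_bigr do rewrite liftK /=.
  have [c0|c0] := eqVneq (c ord0) 0.
    rewrite c0 rmorph0 mul0r add0r => /ib ci i.
    by case: (unliftP ord0 i) => [j ->|->//]; apply: ci.
  move=> h; case: noc; exists (fun i => - (c ord0)^-1 * c (lift ord0 i)).
  have := subspaceZ (c ord0)^-1 sW h.
  rewrite mulrDr mulrA -rmorphM mulVf // rmorph1 mul1r.
  congr (W (_ + _)); rewrite mulr_sumr -sumrN; apply: eq_bigr => i _.
  by rewrite mulrA -rmorphM mulNr rmorphN mulNr opprK.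
by move/maxn; rewrite ltnn.
Qed.

Lemma has_dim_add U V W n k : subspace U -> subspace V -> subspace W ->
  V `<=` U -> W `<=` V ->
  has_dim U V n -> has_dim V W k -> has_dim U W (n + k).
Proof.
move=> sU sV sW VU WV [b [Ub ib gb]] [f [Vf i_f gf]].
have splitl i : split (lshift k i) = inl i := unsplitK (inl i : 'I_n + 'I_k).
have splitr i : split (rshift n i) = inr i := unsplitK (inr i : 'I_n + 'I_k).
pose g i := match split i with inl j => b j | inr j => f j end.
have combg (c : 'I_(n + k) -> K) :
  comb c g = comb (fun i => c (lshift k i)) b + comb (fun i => c (rshift n i)) f.
  by rewrite /comb big_split_ord /=; congr (_ + _); apply: eq_bigr => i _;
     rewrite /g ?splitl ?splitr.
exists g; split.
- by move=> i; rewrite /g; case: (split i) => j //; apply: VU.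
- move=> c; rewrite -/(comb c g) combg => h.
  have Vc : V (comb (fun i => c (lshift k i)) b).
    apply: (subspace_trans (b := - comb (fun i => c (rshift n i)) f)) => //.
      by rewrite opprK; apply: WV.
    by apply: subspaceN => //; apply: subspace_comb.
  have cl := ib _ Vc.
  move: h; rewrite /comb big1 ?add0r => [h|i _]; last by rewrite cl rmorph0 mul0r.
  have cr := i_f _ h.
  by move=> i; case: (split_ordP i) => j ->; [apply: cl | apply: cr].
- move=> z Uz; have [c Vz] := gb z Uz; have [d Wz] := gf _ Vz.
  exists (fun i => match split i with inl j => c j | inr j => d j end).
  rewrite -/(comb _ g) combg opprD addrA; move: Wz.
  by congr (W (_ - _ - _)); apply: eq_bigr => i _;
     rewrite ?splitl ?splitr.
Qed.

Lemma has_dim0 U : U 0 -> has_dim U U 0.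
Proof.
move=> U0; exists (fun=> 0); split=> [//|c _ []//|z Uz].
by exists (fun=> 0); rewrite big_ord0 subr0.
Qed.

(* Multiplication by g induces an isomorphism from U' / W' onto U / W. *)
Lemma has_dim_mul U W U' W' n g : subspace W ->
  (forall z, U' z -> U (g * z)) -> (forall z, W' z -> W (g * z)) ->
  (forall z, U' z -> W (g * z) -> W' z) ->
  (forall z, U z -> exists2 z', U' z' & W (z - g * z')) ->
  subspace U' -> has_dim U W n -> has_dim U' W' n.
Proof.
move=> sW gU gW WW' sur sU' [b [Ub ib gb]].
pose f i := s2val (cid2 (sur _ (Ub i))).
have Uf i : U' (f i) := s2valP (cid2 (sur _ (Ub i))).
have Wf i : W (b i - g * f i) := s2valP' (cid2 (sur _ (Ub i))).
have bf c : W (comb c b - g * comb c f).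
  rewrite /comb mulr_sumr -sumrB; apply: subspace_sum => // i.
  by rewrite mulrCA -mulrBr; apply: subspaceZ.
exists f; split=> //.
- move=> c /gW Wc; apply: ib.
  by apply: subspace_trans Wc => //; apply: bf.
- move=> z Uz; have [c Wz] := gb _ (gU z Uz); exists c.
  apply: WW'; first by apply: subspaceB => //; apply: subspace_comb.
  have := subspaceD sW Wz (bf c); congr (W _).
  by rewrite mulrBr addrA subrK.
Qed.

(** The kernel of the map from [U] to U' / W' lies in [W], so a family in [U] that is independent
    modulo [W] stays so modulo [W']. *)
Lemma has_dim_inj U W U' W' n : subspace W -> subspace W' ->
  subspace U -> U `<=` U' -> (forall z, U z -> W' z -> W z) ->
  has_dim U' W' n -> exists2 k, (k <= n)%N & has_dim U W k.
Proof.
move=> sW sW' sU UU' WW' [b hb]; apply: has_dim_le => // k f Uf i_f.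
apply: (indep_mod_le sW' hb) => [i|c Wc]; first exact: UU'.
by apply: i_f; apply: WW' => //; apply: subspace_comb.
Qed.

Lemma has_dim_rV U W n (phi : 'rV[K]_n -> F) :
  (forall c u v, phi (c *: u + v) = iota c * phi u + phi v) ->
  (forall v, U (phi v)) -> (forall v, W (phi v) -> v = 0) ->
  (forall z, U z -> exists v, W (z - phi v)) -> has_dim U W n.
Proof.
move=> philin Uphi phi0 sur.
have phiD0 : phi 0 = 0.
  have := philin (-1) 0 0; rewrite scaler0 addr0 rmorphN1 mulN1r addNr.
  by [].
have phiE c : phi (\row_i c i) = comb c (fun i => phi (delta_mx 0 i)).
  rewrite [X in phi X]row_sum_delta /comb.
  elim: (index_enum _) => [|i s IHs]; first by rewrite !big_nil.
  by rewrite !big_cons philin IHs mxE.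
exists (fun i => phi (delta_mx 0 i)); split=> //.
- move=> c; rewrite -/(comb _ _) -phiE => /phi0/rowP h i.
  by have := h i; rewrite !mxE.
- move=> z /sur [v Wv]; exists (fun i => v 0 i).
  rewrite -/(comb _ _) -phiE; move: Wv; congr (W (_ - phi _)).
  by apply/rowP => i; rewrite mxE.
Qed.

End Dimension.

(** * Places *)

HB.instance Definition _ (K F : fieldType) (iota : {rmorphism K -> F})
  (P : place iota) := GRing.isSubringClosed.Build F (vring P) (vring_subring P).

Section PlaceTheory.
Variables (K F : fieldType) (iota : {rmorphism K -> F}).
Implicit Types (P : place iota).

Lemma place_ext P P' : vring P =i vring P' -> P = P'.
Proof.
case: P P' => [O a1 a2 a3 a4 a5] [O' b1 b2 b3 b4 b5] /= eqO.
have eO : O = O' by apply/funext => z; apply: eqO.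
subst O'; congr Place; exact: Prop_irrelevance.
Qed.

Lemma videalE P z : (z \in videal P) = (z == 0) || (z^-1 \notin vring P).
Proof.
rewrite /videal /vunit !inE; have [->|z0] := eqVneq z 0; first by rewrite rpred0.
by have [zO|zO] := boolP (z \in vring P); have := vring_total P z;
   rewrite ?(negPf zO) //= => ->.
Qed.

Lemma videal_vring P z : z \in videal P -> z \in vring P.
Proof. by case/andP. Qed.

Lemma videal0 P : 0 \in videal P.
Proof. by rewrite videalE eqxx. Qed.

Lemma vunitP P z :
  reflect [/\ z != 0, z \in vring P & z^-1 \in vring P] (z \in vunit P).
Proof. exact: and3P. Qed.

Lemma vunitE P z : (z \in vunit P) = (z \in vring P) && (z \notin videal P).
Proof.
rewrite /videal [in RHS]inE negb_and negbK andb_orr andbN /=.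
by rewrite andb_idl // => /vunitP[].
Qed.

Lemma videalMl P a w : a \in videal P -> w \in vring P -> w * a \in videal P.
Proof.
rewrite !videalE => aP wO; apply: contraT; rewrite negb_or negbK => /andP[].
rewrite mulf_eq0 negb_or => /andP[w0 a0] h; move: aP; rewrite (negPf a0) /=.
case/negP; have -> : a^-1 = w * (w * a)^-1 by rewrite invfM mulrA divff ?mul1r.
exact: rpredM.
Qed.

Lemma videalMr P a w : a \in videal P -> w \in vring P -> a * w \in videal P.
Proof. by rewrite mulrC; apply: videalMl. Qed.

Lemma vring_div P a b : a != 0 -> b != 0 ->
  (a / b \in vring P) || (b / a \in vring P).
Proof. by move=> a0 b0; have := vring_total P (a / b); rewrite invf_div. Qed.

Lemma videalN P a : a \in videal P -> - a \in videal P.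
Proof. by rewrite -mulN1r => h; apply: videalMl => //; rewrite rpredN1. Qed.

Lemma videalD P a b : a \in videal P -> b \in videal P -> a + b \in videal P.
Proof.
have [->|a0] := eqVneq a 0; first by rewrite add0r.
have [->|b0] := eqVneq b 0; first by rewrite addr0.
wlog h : a b a0 b0 / a / b \in vring P => [H|] aP bP.
  have [h|h] := orP (vring_div P a0 b0); first exact: H.
  by rewrite addrC; apply: H.
have -> : a + b = (a / b + 1) * b by rewrite mulrDl mul1r divfK.
by apply: videalMl => //; rewrite rpredD ?rpred1.
Qed.

Lemma videalB P a b : a \in videal P -> b \in videal P -> a - b \in videal P.
Proof. by move=> aP bP; rewrite videalD ?videalN. Qed.

Lemma videal_sum P (I : Type) (r : seq I) (Q : pred I) (G : I -> F) :
  (forall i, Q i -> G i \in videal P) -> \sum_(i <- r | Q i) G i \in videal P.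
Proof.
by move=> h; elim/big_ind: _ => //; [exact: videal0 | exact: videalD].
Qed.

Lemma videal_subspace P : subspace iota [set` videal P].
Proof.
split=> /= [|c a b aP bP]; first exact: videal0.
by rewrite videalD // videalMl // vring_const.
Qed.

Lemma vunitM P a b : a \in vunit P -> b \in vunit P -> a * b \in vunit P.
Proof.
move=> /vunitP[a0 aO aV] /vunitP[b0 bO bV]; apply/vunitP.
by rewrite mulf_neq0 // invfM !rpredM.
Qed.

Lemma vunitV P a : a \in vunit P -> a^-1 \in vunit P.
Proof. by move=> /vunitP[a0 aO aV]; apply/vunitP; rewrite invr_eq0 invrK. Qed.

Lemma vunit1 P : 1 \in vunit P.
Proof. by apply/vunitP; rewrite oner_neq0 invr1 rpred1. Qed.

Lemma vunit_const P c : c != 0 -> iota c \in vunit P.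
Proof.
by move=> c0; apply/vunitP; rewrite fmorph_eq0 -fmorphV !vring_const.
Qed.

Lemma const_videal P c : (iota c \in videal P) = (c == 0).
Proof.
have [->|c0] := eqVneq c 0; first by rewrite rmorph0 videal0.
by apply: negbTE; have := vunit_const P c0; rewrite vunitE => /andP[].
Qed.

Lemma videalNunit P a : a \in videal P -> a \notin vunit P.
Proof. by rewrite vunitE => ->; rewrite andbF. Qed.

Lemma vunitD P a b : a \in vunit P -> b \in videal P -> a + b \in vunit P.
Proof.
rewrite !vunitE => /andP[aO aP] bP; rewrite rpredD ?(videal_vring bP) //=.
by apply: contra aP => h; rewrite -(addrK b a) videalB.
Qed.

End PlaceTheory.

(** * Existence of places *)

Section PlaceExistence.
Variables (K F : fieldType) (iota : {rmorphism K -> F}).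
Implicit Types (A S : set F).
Add Ring F_ring : (ring_theory_of F).

Definition is_subring A : Prop :=
  [/\ A 1, forall a b, A a -> A b -> A (a - b) &
      forall a b, A a -> A b -> A (a * b)].

Definition coefs_in A (q : {poly F}) : Prop := forall i, A q`_i.

Definition adjunction A z : set F :=
  [set w | exists2 q, coefs_in A q & w = q.[z]].

Lemma is_subring0 A : is_subring A -> A 0.
Proof. by case=> A1 AB _; rewrite -(subrr 1); apply: AB. Qed.

Lemma is_subringN A a : is_subring A -> A a -> A (- a).
Proof.
move=> sA Aa; rewrite -sub0r; case: (sA) => _ AB _.
by apply: AB => //; apply: is_subring0.
Qed.

Lemma is_subringD A a b : is_subring A -> A a -> A b -> A (a + b).
Proof.
move=> sA Aa Ab; rewrite -[b]opprK; case: (sA) => _ AB _.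
by apply: AB => //; apply: is_subringN.
Qed.

Lemma is_subringX A a n : is_subring A -> A a -> A (a ^+ n).
Proof.
case=> A1 _ AM Aa; elim: n => [|n IHn]; first by rewrite expr0.
by rewrite exprS; apply: AM.
Qed.

Lemma is_subring_sum A (I : Type) (r : seq I) (G : I -> F) :
  is_subring A -> (forall i, A (G i)) -> A (\sum_(i <- r) G i).
Proof.
move=> sA AG; elim/big_ind: _ => //; first exact: is_subring0.
by move=> a b; apply: is_subringD.
Qed.

Lemma coefs_inC A c : is_subring A -> A c -> coefs_in A c%:P.
Proof. by move=> sA Ac i; rewrite coefC; case: ifP => // _; apply: is_subring0. Qed.

Lemma coefs_inX A : is_subring A -> coefs_in A 'X.
Proof.
move=> sA i; rewrite coefX; case: eqP => _ /=; first by case: sA.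
exact: is_subring0.
Qed.

Lemma coefs_inB A q r : is_subring A -> coefs_in A q -> coefs_in A r ->
  coefs_in A (q - r).
Proof. by move=> [_ AB _] hq hr i; rewrite coefB; apply: AB. Qed.

Lemma coefs_inD A q r : is_subring A -> coefs_in A q -> coefs_in A r ->
  coefs_in A (q + r).
Proof. by move=> sA hq hr i; rewrite coefD; apply: is_subringD. Qed.

Lemma coefs_inM A q r : is_subring A -> coefs_in A q -> coefs_in A r ->
  coefs_in A (q * r).
Proof.
move=> sA hq hr i; rewrite coefM; apply: is_subring_sum => // j.
by case: sA => _ _ AM; apply: AM.
Qed.

Lemma adjunction_subring A z : is_subring A -> is_subring (adjunction A z).
Proof.
move=> sA; split.
- by exists 1%:P; [apply: coefs_inC => //; case: sA | rewrite hornerC].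
- by move=> _ _ [q hq ->] [r hr ->]; exists (q - r);
    [apply: coefs_inB | rewrite hornerD hornerN].
- by move=> _ _ [q hq ->] [r hr ->]; exists (q * r);
    [apply: coefs_inM | rewrite hornerM].
Qed.

Lemma adjunction_sub A z : is_subring A -> A `<=` adjunction A z.
Proof.
by move=> sA a Aa; exists a%:P; rewrite ?hornerC //; apply: coefs_inC.
Qed.

Lemma adjunction_gen A z : is_subring A -> adjunction A z z.
Proof. by move=> sA; exists 'X; rewrite ?hornerX //; apply: coefs_inX. Qed.

(* Descent on the degrees of the two relations expressing that [f] generates
   the unit ideal both in A[z] and in A[1/z]. *)
Lemma unit_ideal_descent A f z n (q r : {poly F}) : is_subring A -> A f ->
  z != 0 -> (size q + size r <= n)%N -> coefs_in A q -> coefs_in A r ->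
  f * q.[z] = 1 -> f * r.[z^-1] = 1 -> exists2 a, A a & f * a = 1.
Proof.
move=> sA Af; elim: n z q r => [|n IHn] z q r z0.
  rewrite leqn0 addn_eq0 size_poly_eq0 => /andP[/eqP-> _] _ _.
  by rewrite horner0 mulr0 => /eqP; rewrite eq_sym oner_eq0.
wlog le_qr : z z0 q r / (size r <= size q)%N => [H|] szqr Aq Ar qz rz.
  have [h|/ltnW h] := leqP (size r) (size q); first exact: (H z z0 q r).
  by apply: (H z^-1 _ r q) => //; rewrite ?invr_eq0 ?invrK // addnC.
have AM a b : A a -> A b -> A (a * b) by case: sA => _ _; apply.
have A1 : A 1 by case: sA.
have [sz1|sz1] := leqP (size q) 1.
  exists q`_0 => //; rewrite -qz [in RHS](size1_polyC sz1).
  by rewrite hornerC.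
case: n IHn szqr => [|n] IHn szqr; first by move: szqr sz1; lia.
pose d := (size q).-1.
have sq : size q = d.+1 by rewrite /d; lia.
(* [w] is the reversal of [r] without its top term; with r_0 the constant coefficient of [r], it
   satisfies f w(z) = (1 - f r_0) z^d. *)
pose w := \poly_(i < d) r`_(d - i); pose q' := \poly_(i < d) q`_i.
have rzE : r.[z^-1] * z ^+ d = r`_0 * z ^+ d + w.[z].
  rewrite (@horner_coef_wide _ d.+1) ?(leq_trans le_qr) ?sq // big_ord_recl.
  rewrite expr0 mulr1 mulrDl; congr (_ + _).
  rewrite horner_poly mulr_suml [RHS](reindex_inj rev_ord_inj) /=.
  apply: eq_bigr => i _; have lid := ltn_ord i.
  rewrite subKn // -mulrA; congr (_ * _); rewrite exprVn /bump /= add1n.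
  have -> : z ^+ d = z ^+ i.+1 * z ^+ (d - i.+1) by rewrite -exprD subnKC.
  by rewrite mulKf // expf_neq0.
have qzE : q.[z] = q'.[z] + q`_d * z ^+ d.
  by rewrite (@horner_coef_wide _ d.+1) ?sq // big_ord_recr horner_poly.
(* Multiplying the relation for [q] by 1 - f r_0 produces the leading term f q_d (1 - f r_0) z^d,
   which the formula for [w] rewrites as f^2 q_d w(z), of degree below d in z. *)
pose q2 := (r`_0)%:P + (f * q`_d)%:P * w + (1 - f * r`_0)%:P * q'.
have Aw : coefs_in A w.
  by move=> i; rewrite coef_poly; case: ifP => // _; apply: is_subring0.
have Aq' : coefs_in A q'.
  by move=> i; rewrite coef_poly; case: ifP => // _; apply: is_subring0.
have d_gt0 : (0 < d)%N by rewrite /d; lia.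
apply: (IHn z q2 r) => //.
- have : (size q2 <= d)%N.
    rewrite (leq_trans (size_polyD _ _)) // geq_max.
    rewrite (leq_trans (size_polyD _ _)) ?geq_max.
      by rewrite mul_polyC (leq_trans (size_scale_leq _ _)) // size_poly.
    rewrite (leq_trans (size_polyC_leq1 _)) //=.
    by rewrite mul_polyC (leq_trans (size_scale_leq _ _)) // size_poly.
  by move: szqr; rewrite sq; lia.
- apply: coefs_inD => //; first apply: coefs_inD => //.
  + exact: coefs_inC.
  + by apply: coefs_inM => //; apply: coefs_inC => //; apply: AM.
  + apply: coefs_inM => //; apply: coefs_inC => //.
    by case: sA => _ AB _; apply: AB => //; apply: AM.
- rewrite !hornerE.
  have -> : w.[z] = r.[z^-1] * z ^+ d - r`_0 * z ^+ d by rewrite rzE addrC addKr.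
  move: rz qz; rewrite qzE; set rz := r.[_]; set qz := q'.[_].
  set zd := z ^+ d; set r0 := r`_0; set qd := q`_d => rz1 qz1.
  transitivity (f * r0 + f * qd * zd * (f * rz - f * r0) +
    (1 - f * r0) * (f * qz)); first by cring F.
  rewrite rz1; transitivity (f * r0 + (1 - f * r0) * (f * (qz + qd * zd))).
    by cring F.
  by rewrite qz1; cring F.
Qed.

(* 1/f is integral over A, so its powers lie in a finitely generated A-module. *)
Lemma unit_ideal_powers A f (q : {poly F}) n : is_subring A -> f != 0 ->
  coefs_in A q -> f * q.[f] = 1 ->
  exists g : {poly F}, [/\ coefs_in A g, (size g <= size q)%N &
    f^-1 ^+ n = g.[f^-1]].
Proof.
move=> sA f0 Aq fq; have AM a b : A a -> A b -> A (a * b) by case: sA => _ _; apply.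
set w := f^-1; pose k := size q.
have k_gt0 : (0 < k)%N.
  rewrite size_poly_gt0; apply: contra_eq_neq fq => ->.
  by rewrite horner0 mulr0 eq_sym oner_eq0.
have wk : w ^+ k = \sum_(i < k) q`_(k.-1 - i) * w ^+ i.
  rewrite -(prednK k_gt0) exprSr -[w in _ * w]mulr1 -fq [_ * (f * _)]mulrA.
  rewrite mulVf // mul1r horner_coef -/k mulr_sumr (reindex_inj rev_ord_inj) /=.
  rewrite prednK //; apply: eq_bigr => i _.
  have lik : (i <= k.-1)%N by rewrite -ltnS prednK.
  have -> : (k - i.+1 = k.-1 - i)%N by rewrite -{1}(prednK k_gt0) subSS.
  rewrite mulrCA; congr (_ * _).
  have -> : w ^+ k.-1 = w ^+ i * w ^+ (k.-1 - i) by rewrite -exprD subnKC.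
  by rewrite /w -mulrA -exprMn mulVf // expr1n mulr1.
elim: n => [|n [g [Ag szg gE]]].
  exists 1%:P; rewrite expr0 hornerC size_polyC oner_eq0; split=> //.
  by apply: coefs_inC => //; case: sA.
exists (\poly_(i < k) ((if i is i'.+1 then g`_i' else 0) + g`_k.-1 * q`_(k.-1 - i))).
split; last 1 first.
- rewrite exprS gE horner_poly (@horner_coef_wide _ k) //.
  under [RHS]eq_bigr do rewrite mulrDl -mulrA.
  rewrite big_split /= -mulr_sumr -wk -(prednK k_gt0) big_ord_recr /=.
  rewrite [in RHS]big_ord_recl mul0r add0r mulrDr; congr (_ + _).
    by rewrite mulr_sumr; apply: eq_bigr => i _; rewrite /= exprS mulrCA.
  by rewrite mulrCA -exprS.
- move=> i; rewrite coef_poly; case: ifP => _; last exact: is_subring0.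
  apply: is_subringD => //; last exact: AM.
  by case: i => [|i]; [exact: is_subring0 | exact: Ag].
- exact: size_poly.
Qed.

Lemma is_subring_bigcup (C : set (set F)) : C !=set0 -> total_on C subset ->
  C `<=` is_subring -> is_subring (\bigcup_(X in C) X).
Proof.
move=> [X0 CX0] totC sC.
have join a b : (\bigcup_(X in C) X) a -> (\bigcup_(X in C) X) b ->
    exists2 X, C X & X a /\ X b.
  move=> [X CX Xa] [Y CY Yb]; have [XY|YX] := totC _ _ CX CY.
    by exists Y => //; split=> //; apply: XY.
  by exists X => //; split=> //; apply: YX.
split; first by exists X0 => //; case: (sC _ CX0).
- move=> a b aC bC; have [X CX [Xa Xb]] := join _ _ aC bC.
  by exists X => //; case: (sC _ CX) => _ h _; apply: h.
- move=> a b aC bC; have [X CX [Xa Xb]] := join _ _ aC bC.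
  by exists X => //; case: (sC _ CX) => _ _; apply.
Qed.

(** The last hypothesis says that 1 / f is not in S[f]. A subring maximal among those containing S
    and f but not 1 / f is a valuation ring: if it missed both z and 1 / z, then 1 / f would lie in
    both enlargements, and the descent would put it into the ring itself. *)
Lemma place_exists (S : set F) (f : F) : is_subring S ->
  (forall c, S (iota c)) -> f != 0 -> (forall q, coefs_in S q -> f * q.[f] <> 1) ->
  exists2 P : place iota, (forall z, S z -> z \in vring P) & f \in videal P.
Proof.
move=> sS SK f0 fN.
pose good A := [/\ is_subring A, S `<=` A, A f & ~ A f^-1].
have goodS : good (adjunction S f).
  split; [exact: adjunction_subring | exact: adjunction_sub |
          exact: adjunction_gen | ].
  by move=> [q hq fV]; apply: (fN q hq); rewrite -fV divff.
have [|A [goodA maxA]] := @Zorn_bigcup F (fun A => A = set0 \/ good A).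
  move=> C hC totC; have [[X CX gX]|noX] := EM (exists2 X, C X & good X); last first.
    left; apply/seteqP; split=> // a [X CX Xa].
    case: (hC X CX) => [X0|gX]; first by move: Xa; rewrite X0.
    by case: noX; exists X.
  right; pose C' := [set Y | C Y /\ good Y].
  have -> : \bigcup_(X in C) X = \bigcup_(X in C') X.
    apply/seteqP; split=> a [Y CY Ya]; last by exists Y => //; case: CY.
    exists Y => //; split=> //; case: (hC Y CY) => // Y0.
    by move: Ya; rewrite Y0.
  have [_ SX Xf _] := gX; split.
  - apply: is_subring_bigcup; first by exists X.
      by move=> Y Z [CY _] [CZ _]; apply: totC.
    by move=> Y [_ []].
  - by move=> a Sa; exists X => //; apply: SX.
  - by exists X.
  - by move=> [Y [_ [_ _ _ h]]].
case: goodA => [A0|[sA SA Af AfV]].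
  case: (maxA (adjunction S f)); last by right.
  rewrite A0 properEneq; split=> //; apply/eqP => h.
  have : adjunction S f f by apply: adjunction_gen.
  by rewrite -h.
have grow z : ~ A z -> exists2 q, coefs_in A q & f * q.[z] = 1.
  move=> nAz; have [[q hq fV]|nofV] := EM (adjunction A z f^-1).
    by exists q => //; rewrite -fV divff.
  case: (maxA (adjunction A z)).
    rewrite properEneq; split; last exact: adjunction_sub.
    by apply/eqP => h; apply: nAz; rewrite h; apply: adjunction_gen.
  right; split=> //; [exact: adjunction_subring | | exact: adjunction_sub].
  by move=> a /SA; apply: adjunction_sub.
have Atot z : A z \/ A z^-1.
  have [Az|nAz] := EM (A z); first by left.
  have [Az|nAz'] := EM (A z^-1); first by right.
  have z0 : z != 0.
    by apply/eqP => z0; apply: nAz; rewrite z0; apply: is_subring0.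
  have [q hq qz] := grow _ nAz; have [r hr rz] := grow _ nAz'.
  have [a Aa fa] := unit_ideal_descent sA Af z0 (leqnn _) hq hr qz rz.
  by case: AfV; have <- : a = f^-1 by apply: (mulfI f0); rewrite fa divff.
pose O : {pred F} := fun z => `[< A z >].
have OE z : z \in O = `[< A z >] by [].
have Osub : subring_closed O.
  case: sA => A1 AB AM; split; first exact/asboolP.
    by move=> a b /asboolP Aa /asboolP Ab; apply/asboolP; apply: AB.
  by move=> a b /asboolP Aa /asboolP Ab; apply/asboolP; apply: AM.
have Oc c : iota c \in O by apply/asboolP/SA.
have Of : exists2 z, z \in O & forall c, z != iota c.
  exists f; first exact/asboolP.
  move=> c; apply/eqP => fc; apply: AfV; rewrite fc -fmorphV.
  exact: SA.
have ON : exists z, z \notin O.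
  by exists f^-1; apply/asboolP.
have Ot z : (z \in O) || (z^-1 \in O).
  by case: (Atot z) => h; apply/orP; [left|right]; apply/asboolP.
exists (Place Osub Oc Of ON Ot); first by move=> z Sz; apply/asboolP/SA.
by rewrite videalE (negPf f0); apply/asboolP.
Qed.

End PlaceExistence.

(** * Counting relations over K[h(Y)] *)

Lemma linear_kernel (K : fieldType) n k (f : 'rV[K]_n -> 'rV[K]_k) :
  linear f -> (k < n)%N -> exists2 v, v != 0 & f v = 0.
Proof.
move=> lf ltkn.
pose g : {linear 'rV[K]_n -> 'rV[K]_k} :=
  HB.pack f (GRing.isLinear.Build K 'rV[K]_n 'rV[K]_k *:%R f lf).
have [i nzi] : exists i, row i (kermx (lin1_mx g)) != 0.
  apply/existsP; apply: contraLR ltkn; rewrite negb_exists => /forallP h.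
  have kM0 : kermx (lin1_mx g) = 0 by apply/row_matrixP => i; rewrite row0;
    have := h i; rewrite negbK => /eqP.
  have := mxrank_ker (lin1_mx g); rewrite kM0 mxrank0 => /esym/eqP.
  by rewrite subn_eq0 => h'; rewrite -leqNgt (leq_trans h' (rank_leq_col _)).
exists (row i (kermx (lin1_mx g))) => //.
by rewrite -[f _]/(g _) -(mul_rV_lin1 g) -row_mul mulmx_ker row0.
Qed.

Section Evaluation.
Variables (K F : fieldType) (iota : {rmorphism K -> F}).
Implicit Types (Y : F) (p q : {poly K}).

Definition ev Y p : F := (map_poly iota p).[Y].

Lemma evD Y p q : ev Y (p + q) = ev Y p + ev Y q.
Proof. by rewrite /ev rmorphD hornerD. Qed.
Lemma evN Y p : ev Y (- p) = - ev Y p.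
Proof. by rewrite /ev rmorphN hornerN. Qed.
Lemma evB Y p q : ev Y (p - q) = ev Y p - ev Y q.
Proof. by rewrite evD evN. Qed.
Lemma evM Y p q : ev Y (p * q) = ev Y p * ev Y q.
Proof. by rewrite /ev rmorphM hornerM. Qed.
Lemma ev0 Y : ev Y 0 = 0.
Proof. by rewrite /ev rmorph0 horner0. Qed.
Lemma evC Y c : ev Y c%:P = iota c.
Proof. by rewrite /ev map_polyC hornerC. Qed.
Lemma ev1 Y : ev Y 1 = 1.
Proof. by rewrite evC rmorph1. Qed.
Lemma evX Y : ev Y 'X = Y.
Proof. by rewrite /ev map_polyX hornerX. Qed.
Lemma evZ Y c p : ev Y (c *: p) = iota c * ev Y p.
Proof. by rewrite -mul_polyC evM evC. Qed.
Lemma evXn Y p n : ev Y (p ^+ n) = ev Y p ^+ n.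
Proof. by elim: n => [|n IHn]; rewrite ?expr0 ?ev1 // !exprS evM IHn. Qed.
Lemma ev_sum Y (I : Type) (r : seq I) (P : pred I) (G : I -> {poly K}) :
  ev Y (\sum_(i <- r | P i) G i) = \sum_(i <- r | P i) ev Y (G i).
Proof. exact: (big_morph _ (evD Y) (ev0 Y)). Qed.
Lemma ev_comp Y p q : ev (ev Y q) p = ev Y (p \Po q).
Proof. by rewrite /ev map_comp_poly horner_comp. Qed.
Lemma evE Y p : ev Y p = \sum_(i < size p) iota p`_i * Y ^+ i.
Proof.
rewrite /ev horner_coef size_map_poly.
by apply: eq_bigr => i _; rewrite coef_map.
Qed.

Lemma ev_eq0 Y p : transcendental iota Y -> (ev Y p == 0) = (p == 0).
Proof.
move=> trY; have [->|p0] := eqVneq p 0; first by rewrite ev0 eqxx.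
by apply/negP => h; apply: trY; exists p; rewrite ?rootE.
Qed.

Lemma ev_vring (P : place iota) Y p : Y \in vring P -> ev Y p \in vring P.
Proof.
move=> YO; rewrite evE; apply: rpred_sum => i _.
by rewrite rpredM ?rpredX // vring_const.
Qed.

(* F is spanned by 1 and X over K(Y). *)
Definition gen2 Y X : Prop := forall z, exists D a b,
  D != 0 /\ ev Y D * z = ev Y a + ev Y b * X.

Lemma common_denominator Y X n (z : 'I_n -> F) : gen2 Y X ->
  exists D (a b : 'I_n -> {poly K}),
  D != 0 /\ forall i, ev Y D * z i = ev Y (a i) + ev Y (b i) * X.
Proof.
move=> genY.
have /choice[D /choice[a /choice[b h]]] := fun i => genY (z i).
exists (\prod_i D i), (fun i => (\prod_(j | j != i) D j) * a i),
  (fun i => (\prod_(j | j != i) D j) * b i); split.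
  by apply/prodf_neq0 => i _; have [] := h i.
move=> i; rewrite (bigD1 i) //=; set P := \prod_(j | j != i) _.
have [_ e] := h i.
by rewrite !evM mulrAC e mulrC mulrDr mulrA.
Qed.

Lemma size_mul_leq_add (p q : {poly K}) k l :
  (size p <= k.+1)%N -> (size q <= l)%N -> (size (p * q)%R <= k + l)%N.
Proof. by move=> hp hq; rewrite (leq_trans (size_polyMleq p q)) //; lia. Qed.

(** Effective form of [F : K(h(Y))] <= 2 d. After clearing denominators, coefficients of size at
    most J involve n J unknown scalars, and the two coordinates of the sum with respect to 1 and X
    impose fewer linear conditions. *)
Lemma gen2_relation Y X (h : {poly K}) d n (z : 'I_n -> F) :
  transcendental iota Y -> gen2 Y X -> size h = d.+1 -> (d.*2 < n)%N ->
  exists c : 'I_n -> {poly K}, (exists i, c i != 0) /\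
    \sum_i ev (ev Y h) (c i) * z i = 0.
Proof.
move=> trY genY szh ltdn.
have [D [a [b [D0 zE]]]] := common_denominator z genY.
pose M := (\max_i maxn (size (a i)) (size (b i)))%N.
have leM i : (size (a i) <= M)%N /\ (size (b i) <= M)%N.
  by apply/andP; rewrite -geq_max /M (bigD1 i) //= leq_maxl.
(* The least J with (2 d + 1) J > 2 (J d + M), that is, with more unknowns than equations. *)
pose J := (M.*2).+1; pose L := (J * d + M)%N.
pose c (v : 'rV[K]_(n * J)) i : {poly K} := rVpoly (row i (vec_mx v)).
have c_lin k u v i : c (k *: u + v) i = k *: c u i + c v i.
  by rewrite /c !linearP.
pose S (t : 'I_n -> {poly K}) v : {poly K} := \sum_i (c v i \Po h) * t i.
have S_lin (t : 'I_n -> {poly K}) k u v : S t (k *: u + v) = k *: S t u + S t v.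
  rewrite /S scaler_sumr -big_split; apply: eq_bigr => i _.
  by rewrite c_lin comp_polyD comp_polyZ mulrDl scalerAl.
have size_c v i : (size (c v i) <= J)%N by apply: size_poly.
have sizeS (t : 'I_n -> {poly K}) v :
    (forall i, size (t i) <= M)%N -> (size (S t v) <= L)%N.
  move=> ht; rewrite (leq_trans (size_sum _ _ _)) //.
  apply/bigmax_leqP => i _; apply: size_mul_leq_add => //.
  rewrite (leq_trans (size_comp_poly_leq _ _)) // szh /= ltnS leq_mul2r.
  by rewrite (leq_trans (leq_pred _)) ?orbT.
pose phi v : 'rV[K]_(L + L) := row_mx (poly_rV (S a v)) (poly_rV (S b v)).
have phi_lin : linear phi.
  move=> k u v; rewrite /phi !S_lin !linearP /=.
  by rewrite scale_row_mx add_row_mx.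
have [|v v0 phiv] := linear_kernel phi_lin.
  by rewrite /L /J; nia.
have Sv (t : 'I_n -> {poly K}) :
    (forall i, size (t i) <= M)%N -> poly_rV (S t v) = 0 :> 'rV_L ->
    S t v = 0.
  move=> ht h0; rewrite -[S t v](@poly_rV_K _ L) ?h0 ?linear0 //.
  exact: sizeS.
have [Sa Sb] : poly_rV (S a v) = 0 :> 'rV_L /\ poly_rV (S b v) = 0 :> 'rV_L.
  by have := phiv; rewrite /phi -row_mx0 => /eq_row_mx.
exists (c v); split.
  have [i ri] : exists i, row i (vec_mx v) != 0.
    apply/existsP; apply: contraNT v0; rewrite negb_exists => /forallP r0.
    rewrite -(inj_eq (can_inj vec_mxK)) linear0; apply/eqP/row_matrixP => i.
    by rewrite row0; apply/eqP; have := r0 i; rewrite negbK.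
  exists i; apply: contra_neq ri => ci.
  by rewrite -[row _ _]rVpolyK -/(c v i) ci linear0.
have evD0 : ev Y D != 0 by rewrite ev_eq0.
apply: (mulfI evD0); rewrite mulr0 mulr_sumr.
transitivity (ev Y (S a v) + ev Y (S b v) * X).
  rewrite /S !ev_sum mulr_suml -big_split; apply: eq_bigr => i _ /=.
  by rewrite ev_comp mulrCA zE !evM mulrDr mulrA.
rewrite (Sv a _ Sa) ?(Sv b _ Sb) ?ev0 ?mul0r ?addr0 // => i.
  by case: (leM i).
by case: (leM i).
Qed.

End Evaluation.

(** * Discreteness of places and finiteness of residue fields *)

Section Discreteness.
Variables (K F : fieldType) (iota : {rmorphism K -> F}).
Variables (Y X : F).
Hypotheses (trY : transcendental iota Y) (genY : gen2 iota Y X).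
Local Notation ev := (ev iota).
Add Ring F_ring : (ring_theory_of F).

Lemma divpX (c : {poly K}) : c = (c %/ 'X) * 'X + (c`_0)%:P.
Proof.
rewrite {1}(divp_eq c 'X); congr (_ + _).
by rewrite -['X]subr0 -polyC0 modp_XsubC horner_coef0.
Qed.

Lemma ev_coef0 (A : set F) f (c : {poly K}) : is_subring A ->
  (forall a, A (iota a)) -> A f -> exists2 a, A a & ev f c = iota c`_0 + f * a.
Proof.
move=> sA AK Af.
exists (ev f (c %/ 'X)).
  rewrite evE; apply: is_subring_sum => // i; case: (sA) => _ _ AM.
  by apply: AM => //; apply: is_subringX.
by rewrite {1}(divpX c) evD evM evX evC mulrC addrC.
Qed.

(** If all constant terms vanish, every [c i] is divisible by 'X and the nonzero factor [ev Y h]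
    cancels from the relation; the degrees drop, so this stops. *)
Lemma normalized_relation (h : {poly K}) d n (z : 'I_n -> F) :
  h != 0 -> size h = d.+1 -> (d.*2 < n)%N ->
  exists c : 'I_n -> {poly K}, (exists i, (c i)`_0 != 0) /\
    \sum_i ev (ev Y h) (c i) * z i = 0.
Proof.
move=> h0 szh ltdn; have [c [cN0 rel]] := gen2_relation z trY genY szh ltdn.
have f0 : ev Y h != 0 by rewrite ev_eq0.
have [k szc] : exists k, forall i, (size (c i) <= k)%N.
  exists (\max_i size (c i))%N => i; by rewrite (bigD1 i) //= leq_maxl.
elim: k c cN0 rel szc => [|k IHk] c [j cj0] rel szc.
  by have := szc j; rewrite leqn0 size_poly_eq0 (negPf cj0).
have [[i ci]|nc] := EM (exists i, (c i)`_0 != 0); first by exists c; split; [exists i|].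
have cX i : c i = (c i %/ 'X) * 'X.
  rewrite {1}(divpX (c i)); have [->|ci] := eqVneq (c i)`_0 0.
    by rewrite polyC0 addr0.
  by case: nc; exists i.
apply: (IHk (fun i => c i %/ 'X)).
- by exists j; apply: contra_neq cj0 => e; rewrite cX e mul0r.
- apply: (mulfI f0); rewrite mulr0 mulr_sumr -[RHS]rel; apply: eq_bigr => i _.
  by rewrite [in RHS]cX evM evX mulrA [_ * ev _ _]mulrC.
- by move=> i; rewrite size_divp ?polyX_eq0 // size_polyX leq_subLR add1n.
Qed.

(** The constant terms of a normalized relation give a dependence over K in A / h(Y) A. For a
    valuation ring this bounds the residue degree, for an intersection of several the zeros of
    h(Y). *)
Lemma relation_mod (A : set F) (h : {poly K}) d n (z : 'I_n -> F) :
  is_subring A -> (forall a, A (iota a)) -> A (ev Y h) -> (forall i, A (z i)) ->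
  h != 0 -> size h = d.+1 -> (d.*2 < n)%N ->
  exists c : 'I_n -> K, (exists i, c i != 0) /\
    exists2 a, A a & comb iota c z = ev Y h * a.
Proof.
move=> sA AK Af Az h0 szh ltdn.
have [c [cN0 rel]] := normalized_relation z h0 szh ltdn.
exists (fun i => (c i)`_0); split => //.
have /choice[a ha] : forall i, exists a, A a /\
    ev (ev Y h) (c i) = iota (c i)`_0 + ev Y h * a.
  by move=> i; have [a Aa e] := ev_coef0 (c i) sA AK Af; exists a.
exists (\sum_i (- a i) * z i).
  apply: is_subring_sum => // i; case: (sA) => _ _ AM; apply: AM => //.
  by apply: is_subringN => //; case: (ha i).
rewrite /comb mulr_sumr; apply/eqP; rewrite -subr_eq0 -sumrB -[X in _ == X]rel.
apply/eqP/eq_bigr => i _; have [_ ->] := ha i.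
by rewrite mulrA -mulrBl mulrN opprK.
Qed.

Section AtPlace.
Variable P : place iota.
Hypothesis YO : Y \in vring P.

Let Oring : is_subring [set` vring P].
Proof.
by split=> /= [|a b aO bO|a b aO bO]; rewrite ?rpred1 ?rpredB ?rpredM.
Qed.

(** The hypotheses say that v(z_0) > v(z_1) > ... in the value group, with differences below
    v(h(Y)). In a normalized relation take the last j whose coefficient is a unit: earlier z_i have
    larger value, later coefficients are divisible by h(Y), so nothing can cancel the term at j. *)
Lemma chain_bound (h : {poly K}) d n (z : 'I_n -> F) : h != 0 ->
  size h = d.+1 -> ev Y h \in videal P -> (forall i, z i != 0) ->
  (forall i j : 'I_n, (i < j)%N -> z i / z j \in videal P) ->
  (forall i j : 'I_n, (j < i)%N -> ev Y h * (z i / z j) \in videal P) ->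
  (n <= d.*2)%N.
Proof.
move=> h0 szh fP z0 zlt zgt; rewrite leqNgt; apply/negP => ltdn.
have [c [cN0 rel]] := normalized_relation z h0 szh ltdn.
have fO := videal_vring fP.
have [i0 ci0] := cN0.
pose ok (i : 'I_n) := (c i)`_0 != 0.
case: (arg_maxnP (fun i : 'I_n => i : nat) (P := ok) ci0) => j cj maxj.
have cE i : exists2 a, a \in vring P & ev (ev Y h) (c i) = iota (c i)`_0 + ev Y h * a.
  by apply: ev_coef0 => //= a; apply: vring_const.
have cjU : ev (ev Y h) (c j) \in vunit P.
  by have [a aO ->] := cE j; rewrite vunitD ?vunit_const // videalMr.
suff : ev (ev Y h) (c j) \in videal P by move/videalNunit; rewrite cjU.
have -> : ev (ev Y h) (c j) =
    - \sum_(i | i != j) ev (ev Y h) (c i) * (z i / z j).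
  apply/eqP; rewrite -addr_eq0; apply/eqP/(mulIf (z0 j)).
  rewrite mul0r -[RHS]rel [RHS](bigD1 j) //= mulrDl; congr (_ + _).
  by rewrite mulr_suml; apply: eq_bigr => i _; rewrite -mulrA divfK.
apply/videalN/videal_sum => i; rewrite neq_ltn => /orP[ij|ji].
  by apply: videalMl; [exact: zlt | exact: ev_vring].
have ci : (c i)`_0 = 0.
  by apply: contraTeq ji => ci; rewrite -leqNgt; apply: maxj.
have [a aO ->] := cE i; rewrite ci rmorph0 add0r mulrAC.
by apply: videalMr => //; apply: zgt.
Qed.

(** 1, z and z^2 satisfy a relation over K[Y]. Divided by the lowest power of z that occurs, it
    shows that the coefficient of this power is a multiple of z. *)
Lemma divides_poly (z : F) : z != 0 -> z \in vring P ->
  exists h : {poly K}, [/\ h != 0 & exists2 w, w \in vring P & ev Y h = z * w].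
Proof.
move=> z0 zO.
have [c [[i0 ci0] rel]] := @gen2_relation _ _ _ _ _ 'X 1 3
  (fun i => z ^+ i) trY genY (size_polyX _) isT.
rewrite evX in rel; pose ok (i : 'I_3) := c i != 0.
case: (arg_minnP (fun i : 'I_3 => i : nat) (P := ok) ci0) => j cj minj.
exists (c j); split=> //.
exists (- \sum_(i | i != j) ev Y (c i) * z ^+ (i - j.+1)).
  rewrite rpredN; apply: rpred_sum => i _.
  by rewrite rpredM ?rpredX // ev_vring.
have zj0 : z ^+ j != 0 by rewrite expf_neq0.
apply: (mulIf zj0); rewrite mulrN mulNr; apply/eqP; rewrite -addr_eq0.
rewrite -[X in _ == X]rel [X in _ == X](bigD1 j) //=; apply/eqP; congr (_ + _).
rewrite mulr_sumr mulr_suml; apply: eq_bigr => i ij.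
have [ci|ci] := eqVneq (c i) 0; first by rewrite ci ev0 !(mul0r, mulr0).
have ltji : (j < i)%N by rewrite ltn_neqAle eq_sym ij minj.
have -> : z ^+ i = z ^+ (i - j.+1) * (z * z ^+ j).
  by rewrite -exprS -exprD subnK.
by cring F.
Qed.

Lemma exists_zero_poly : exists h : {poly K}, h != 0 /\ ev Y h \in videal P.
Proof.
have [z zO] := vring_proper P.
have z0 : z != 0 by apply: contraNneq zO => ->; rewrite rpred0.
have zP : z^-1 \in videal P by rewrite videalE invrK zO orbT.
have [|h [h0 [w wO hE]]] := divides_poly _ (videal_vring zP).
  by rewrite invr_eq0.
by exists h; split; rewrite // hE videalMr.
Qed.

(** If the maximal ideal were not principal, each nonzero x in it would admit y in it with x / y in
    it too; iterating from h(Y) builds a chain longer than [chain_bound] allows. *)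
Lemma exists_uniformizer :
  exists t : F, [/\ t != 0, t \in videal P & forall z, z \in videal P -> z / t \in vring P].
Proof.
have [h [h0 fP]] := exists_zero_poly; set f := ev Y h in fP.
have f0 : f != 0 by rewrite ev_eq0.
apply: contrapT => no_t.
have /choice[next nextP] : forall x : F, exists y : F, x != 0 -> x \in videal P ->
    [/\ y != 0, y \in videal P & x / y \in videal P].
  move=> x; have [->|x0] := eqVneq x 0; first by exists 0.
  have [xP|xP] := boolP (x \in videal P); last by exists 0.
  have [y yP yx] : exists2 y, y \in videal P & y / x \notin vring P.
    apply: contrapT => h'; apply: no_t; exists x; split=> // z zP.
    by apply: contrapT => /negP zx; apply: h'; exists z.
  exists y => _ _; split=> //.
    by apply: contraNneq yx => ->; rewrite mul0r rpred0.
  by rewrite videalE invf_div yx orbT.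
pose z i := iter i next f.
have zP i : z i != 0 /\ z i \in videal P.
  by elim: i => [//|i [zi0 ziP]]; have [] := nextP _ zi0 ziP.
have zS i : z i / z i.+1 \in videal P.
  by have [zi0 ziP] := zP i; have [] := nextP _ zi0 ziP.
have zlt i j : (i < j)%N -> z i / z j \in videal P.
  elim: j => [//|j IHj]; rewrite ltnS leq_eqVlt => /orP[/eqP-> //|/IHj h'].
  have -> : z i / z j.+1 = z i / z j * (z j / z j.+1).
    by rewrite mulrA divfK //; case: (zP j).
  by apply: videalMl => //; apply: videal_vring.
have szh : size h = (size h).-1.+1 by rewrite prednK // size_poly_gt0.
have := @chain_bound h (size h).-1 (size h).-1.*2.+1 (fun i => z i) h0 szh fP.
rewrite ltnn => H; suff: false by []. 
apply: H => [i|i j|i j ji]; first by case: (zP i).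
  exact: zlt.
(* The chain starts at [f], so [f / z j] lies in the valuation ring. *)
rewrite mulrCA; apply: videalMr; first by case: (zP i).
case: (nat_of_ord j) => [|k]; first by rewrite divff // rpred1.
by apply/videal_vring/(zlt 0%N k.+1).
Qed.

(** A nonzero z divisible by every power of t has a multiple h(Y) with the same property, and the
    powers of t then violate [chain_bound]. *)
Lemma place_discrete : exists t : F, [/\ t != 0, prime_element P t &
  forall z, z != 0 -> exists (n : int) w, w \in vunit P /\ z = t ^ n * w].
Proof.
have [t [t0 tP tdiv]] := exists_uniformizer; exists t; split=> //.
  move=> z; split=> [zP|[w wO ->]]; last exact: videalMr.
  by exists (z / t); [exact: tdiv | rewrite mulrC divfK].
have pos z : z != 0 -> z \in vring P ->
    exists (n : nat) w, w \in vunit P /\ z = t ^+ n * w.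
  move=> z0 zO; apply: contrapT => noz.
  have zt n : z / t ^+ n \in vring P.
    elim: n => [|n IHn]; first by rewrite expr0 divr1.
    rewrite exprSr invfM mulrA; apply: tdiv.
    have : z / t ^+ n \notin vunit P.
      apply/negP => u; apply: noz; exists n, (z / t ^+ n).
      by split; rewrite // mulrC divfK // expf_neq0.
    by rewrite vunitE IHn /= negbK.
  have [h [h0 [w wO hE]]] := divides_poly z0 zO.
  have szh : size h = (size h).-1.+1 by rewrite prednK // size_poly_gt0.
  pose n := (size h).-1.*2.+1.
  have tn0 k : t ^+ k != 0 by rewrite expf_neq0.
  have ht k : ev Y h / t ^+ k \in vring P by rewrite hE mulrAC rpredM.
  have hP : ev Y h \in videal P.
    by rewrite -(divfK t0 (ev Y h)) videalMl //; have := ht 1%N; rewrite expr1.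
  have := @chain_bound h (size h).-1 n (fun i => t ^+ (n - i)) h0 szh hP.
  rewrite ltnn => H; suff: false by [].
  apply: H => [i|i j ij|i j ji]; first exact: tn0.
    have -> : (n - i = (j - i).-1 + 1 + (n - j))%N by have := ltn_ord j; lia.
    by rewrite exprD mulfK // exprD expr1 videalMl // rpredX // videal_vring.
  have -> : (n - j = (i - j) + (n - i))%N by have := ltn_ord i; lia.
  rewrite exprD invfM [t ^+ (n - i) * _]mulrCA divff // mulr1.
  have -> : ev Y h / t ^+ (i - j) = ev Y h / t ^+ (i - j).+1 * t.
    by rewrite exprSr invfM mulrA divfK.
  exact: videalMl.
move=> z z0; have /orP[zO|zO] := vring_total P z.
  by have [n [w [wU zE]]] := pos z z0 zO; exists n, w.
have [|n [w [wU zE]]] := pos z^-1 _ zO; first by rewrite invr_eq0.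
exists (- n%:Z), w^-1; split; first exact: vunitV.
by rewrite -exprnN -invfM -zE invrK.
Qed.

Lemma residue_has_dim :
  exists n, has_dim iota [set` vring P] [set` videal P] n.
Proof.
have [h [h0 fP]] := exists_zero_poly.
have szh : size h = (size h).-1.+1 by rewrite prednK // size_poly_gt0.
have [||n _ ?] := @has_dim_le _ _ iota [set` vring P] [set` videal P] (size h).-1.*2.
- exact: videal_subspace.
- move=> k f fO indf; rewrite leqNgt; apply/negP => ltk.
  have [c [[i ci] [a aO cE]]] := @relation_mod [set` vring P] h _ _ f Oring
    (@vring_const _ _ _ P) (videal_vring fP) fO h0 szh ltk.
  by move: ci; rewrite (indf c) ?eqxx //= cE videalMr.
- by exists n.
Qed.

End AtPlace.
End Discreteness.

(** * Valuations and weak approximation *)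

Lemma mulrn_lt0_le (a : int) n : a < 0 -> a *+ n <= - n%:Z.
Proof. by move=> a0; elim: n => [|n IHn]; rewrite ?mulr0n // mulrS; lia. Qed.

Lemma mulrn_lt0_dominated (a b : int) n : a < 0 -> (`|b| <= n)%N ->
  a *+ n.+1 + 1 <= b.
Proof. by move=> /(mulrn_lt0_le n.+1); lia. Qed.

Section Valuations.
Variables (K F : fieldType) (iota : {rmorphism K -> F}).
Implicit Types (P : place iota) (s : seq (place iota)) (D : place iota -> int).

Definition uniformizer P (t : F) : Prop := [/\ t != 0, prime_element P t &
  forall z : F, z != 0 -> exists (n : int) w, w \in vunit P /\ z = t ^ n * w].

Hypothesis discrete : forall P, exists t, uniformizer P t.

Local Notation val := valuation.

Lemma prime_videal P (t : F) : prime_element P t -> t \in videal P.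
Proof. by move=> h; apply/h; exists 1; rewrite ?rpred1 ?mulr1. Qed.

Lemma vunitXz P w (n : int) : w \in vunit P -> w ^ n \in vunit P.
Proof.
have vX k u : u \in vunit P -> u ^+ k \in vunit P.
  by move=> uU; elim: k => [|k IHk]; rewrite ?exprS ?vunitM ?vunit1.
by move=> wU; case: n => k; rewrite ?NegzE -?exprnN ?vunitV // vX.
Qed.

Lemma prime_exp_unit P (t : F) (n : int) :
  t != 0 -> prime_element P t -> t ^ n \in vunit P -> n = 0.
Proof.
move=> t0 /prime_videal tP tU.
wlog [k nk] : n tU / exists k : nat, n = k%:Z.
  move=> H; case: n tU => k tU; first by apply: H => //; exists k.
  have tU' := vunitV tU; rewrite invr_expz in tU'.
  apply/eqP; rewrite -oppr_eq0; apply/eqP/H => //.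
  by exists k.+1; rewrite NegzE opprK.
rewrite nk in tU *; case: k {n nk} tU => // k tU.
suff /videalNunit : t ^+ k.+1 \in videal P by rewrite tU.
by rewrite exprS videalMr // rpredX // videal_vring.
Qed.

(** Two prime elements differ by a unit, so two representations of one element make t^(k - n) a
    unit, which forces k = n. *)
Lemma valuationE P (t : F) (n : int) w :
  t != 0 -> prime_element P t -> w \in vunit P -> val P (t ^ n * w) = n.
Proof.
move=> t0 pt wU; apply: xget_unique; first by exists t, w.
move=> k [t' [w' [pt' wU' e]]].
have [a aO ta] := (pt' t).1 (prime_videal pt).
have [b bO tb] := (pt t').1 (prime_videal pt').
have ab : b * a = 1 by apply: (mulfI t0); rewrite mulr1 mulrA -tb -ta.
have b0 : b != 0 by apply: contra_eq_neq ab => ->; rewrite mul0r eq_sym oner_eq0.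
have bU : b \in vunit P.
  by apply/vunitP; split=> //; rewrite -[_^-1]mulr1 -ab mulKf.
have : t ^ (k - n) \in vunit P.
  have -> : t ^ (k - n) = w * w'^-1 * (b ^ k)^-1.
    have /vunitP[w'0 _ _] := wU'.
    have bk0 := expfz_neq0 k b0; have tn0 := expfz_neq0 n t0.
    apply: (mulIf bk0); rewrite divfK //; apply: (mulIf w'0); rewrite divfK //.
    apply: (mulfI tn0); rewrite e tb expfzMl !mulrA -expfzDr //.
    by rewrite [n + _]addrC subrK.
  by rewrite !vunitM ?vunitV ?vunitXz.
by move/(prime_exp_unit t0 pt)/eqP; rewrite subr_eq0 => /eqP.
Qed.

(** Prime elements are nonzero, hence no t^n w vanishes and [xget] returns its default. *)
Lemma valuation0 P : val P 0 = 0.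
Proof.
apply: xgetPN => n [t [w [pt wU e]]].
have [t1 [t10 pt1 _]] := discrete P.
have /vunitP[w0 _ _] := wU.
have t0 : t != 0.
  apply: contraNneq t10 => tE.
  by have [a _ ->] := (pt t1).1 (prime_videal pt1); rewrite tE mul0r.
by have := mulf_neq0 (expfz_neq0 n t0) w0; rewrite -e eqxx.
Qed.

Lemma valuation_spec P (t z : F) : uniformizer P t -> z != 0 ->
  exists2 w, w \in vunit P & z = t ^ (val P z) * w.
Proof.
move=> [t0 pt gen] z0; have [n [w [wU zE]]] := gen z z0.
by exists w; rewrite // {2}zE (valuationE n t0 pt wU).
Qed.

Lemma valuation_uniformizer P (t : F) : uniformizer P t -> val P t = 1.
Proof. by case=> t0 pt _; rewrite -(valuationE 1 t0 pt (vunit1 P)) mulr1. Qed.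

Lemma valuationM P (a b : F) : a != 0 -> b != 0 -> val P (a * b) = val P a + val P b.
Proof.
move=> a0 b0; have [t ut] := discrete P; have [t0 pt _] := ut.
have [w wU aE] := valuation_spec ut a0; have [v vU bE] := valuation_spec ut b0.
rewrite {1}aE {1}bE mulrACA -expfzDr // (valuationE _ t0 pt) //.
exact: vunitM.
Qed.

Lemma valuation_unit P w : w \in vunit P -> val P w = 0.
Proof.
have [t [t0 pt _]] := discrete P => wU.
by rewrite -[w]mul1r -[1](expr0z t) (valuationE _ t0 pt).
Qed.

Lemma valuation1 P : val P 1 = 0.
Proof. exact/valuation_unit/vunit1. Qed.

Lemma valuation_const P c : val P (iota c) = 0.
Proof.
have [->|c0] := eqVneq c 0; first by rewrite rmorph0 valuation0.
exact/valuation_unit/vunit_const.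
Qed.

Lemma valuationV P (a : F) : val P a^-1 = - val P a.
Proof.
have [->|a0] := eqVneq a 0; first by rewrite invr0 valuation0.
have := valuation1 P; rewrite -{1}(mulVf a0) valuationM ?invr_eq0 //.
by move/eqP; rewrite addr_eq0 => /eqP.
Qed.

Lemma valuationX P (a : F) n : val P (a ^+ n) = val P a *+ n.
Proof.
have [->|a0] := eqVneq a 0.
  by case: n => [|n]; rewrite ?expr0 ?valuation1 // expr0n valuation0 mul0rn.
elim: n => [|n IHn]; first by rewrite expr0 valuation1.
by rewrite exprS valuationM ?expf_neq0 // IHn mulrS.
Qed.

Lemma valuationXz P a (n : int) : val P (a ^ n) = val P a *~ n.
Proof.
case: n => n; first exact: valuationX.
by rewrite NegzE -exprnN valuationV valuationX mulrNz.
Qed.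

Lemma valuationN P (a : F) : val P (- a) = val P a.
Proof.
have [->|a0] := eqVneq a 0; first by rewrite oppr0.
rewrite -mulN1r valuationM ?oppr_eq0 ?oner_eq0 //.
by rewrite -(rmorphN1 iota) valuation_const add0r.
Qed.

Lemma videal_valuation P (a : F) : a != 0 -> (a \in videal P) = (0 < val P a).
Proof.
have [t ut] := discrete P; have [t0 pt _] := ut.
have tO : t \in vring P by apply/videal_vring/prime_videal.
have pos z : z != 0 -> 0 < val P z -> z \in videal P.
  move=> z0; have [w wU zE] := valuation_spec ut z0.
  case vz : (val P z) zE => [[|k]|k] // -> _; rewrite exprSz -mulrA.
  rewrite videalMr ?prime_videal // rpredM ?rpredX //.
  by case/vunitP: wU.
move=> a0; apply/idP/idP => [aP|]; last exact: pos.
rewrite ltNge le_eqVlt; apply/negP => /orP[/eqP va|va].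
  have [w wU aE] := valuation_spec ut a0.
  move: aE; rewrite va expr0z mul1r => aE.
  by have := videalNunit aP; rewrite aE wU.
have : a^-1 \in videal P by rewrite pos ?invr_eq0 // valuationV oppr_gt0.
move=> aVP; have := videalMr aVP (videal_vring aP); rewrite mulVf // => h.
by have := videalNunit h; rewrite vunit1.
Qed.

Lemma vring_valuation P (a : F) : a != 0 -> (a \in vring P) = (0 <= val P a).
Proof.
move=> a0; have := videalE P a^-1; rewrite invr_eq0 (negPf a0) invrK /=.
rewrite videal_valuation ?invr_eq0 // valuationV oppr_gt0 => /esym h.
by rewrite -[LHS]negbK h -leNgt.
Qed.

(* v_P(z) >= n, with v_P(0) = +oo *)
Definition vge P (n : int) (z : F) : Prop := z = 0 \/ n <= val P z.

(** Reduces closure of [vge] under addition, the zero element included, to that of the valuation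
    ring. *)
Lemma vge_scale P (t : F) n (z : F) : uniformizer P t ->
  vge P n z <-> z * t ^ (- n) \in vring P.
Proof.
move=> ut; have [t0 _ _] := ut; have tn0 := expfz_neq0 (- n) t0.
have [->|z0] := eqVneq z 0; first by rewrite mul0r rpred0; split=> // _; left.
rewrite vring_valuation ?mulf_neq0 // valuationM // valuationXz.
rewrite (valuation_uniformizer ut) -mulrzr mul1r /= intz subr_ge0.
by split=> [[/eqP|//]|h]; [rewrite (negPf z0) | right].
Qed.

Lemma vgeD P n (a b : F) : vge P n a -> vge P n b -> vge P n (a + b).
Proof.
have [t ut] := discrete P.
by rewrite !(vge_scale _ _ ut) mulrDl => aO bO; rewrite rpredD.
Qed.

Lemma vgeN P n (a : F) : vge P n a -> vge P n (- a).
Proof. by case=> [->|h]; [left; rewrite oppr0 | right; rewrite valuationN]. Qed.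

Lemma vgeB P n (a b : F) : vge P n a -> vge P n b -> vge P n (a - b).
Proof. by move=> ha hb; apply: vgeD => //; apply: vgeN. Qed.

Lemma vgeM P n m a b : vge P n a -> vge P m b -> vge P (n + m) (a * b).
Proof.
have [->|a0] := eqVneq a 0; first by rewrite mul0r; left.
have [->|b0] := eqVneq b 0; first by rewrite mulr0; left.
case=> [/eqP|ha]; first by rewrite (negPf a0).
case=> [/eqP|hb]; first by rewrite (negPf b0).
by right; rewrite valuationM // lerD.
Qed.

Lemma vge_le P n m z : n <= m -> vge P m z -> vge P n z.
Proof. by move=> nm [->|h]; [left | right; apply: le_trans nm h]. Qed.

Lemma vge_const P c : vge P 0 (iota c).
Proof. by right; rewrite valuation_const. Qed.

Lemma vge_sum P n (I : Type) (r : seq I) (Q : pred I) (G : I -> F) :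
  (forall i, Q i -> vge P n (G i)) -> vge P n (\sum_(i <- r | Q i) G i).
Proof. by move=> h; elim/big_ind: _ => //; [left | move=> *; apply: vgeD]. Qed.

Lemma vge_vring P (z : F) : vge P 0 z <-> z \in vring P.
Proof.
have [->|z0] := eqVneq z 0; first by rewrite rpred0; split=> // _; left.
rewrite vring_valuation //; split=> [[/eqP|//]|h]; last by right.
by rewrite (negPf z0).
Qed.

Lemma vge_videal P (z : F) : vge P 1 z <-> z \in videal P.
Proof.
have [->|z0] := eqVneq z 0; first by rewrite videal0; split=> // _; left.
rewrite videal_valuation //; split=> [[/eqP|//]|h]; last by right.
by rewrite (negPf z0).
Qed.

Lemma valuationD_lt P (a b : F) : a != 0 -> vge P (val P a + 1) b ->
  a + b != 0 /\ val P (a + b) = val P a.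
Proof.
move=> a0 hb.
have nlt : ~ vge P (val P a + 1) a.
  by case=> [/eqP|]; [rewrite (negPf a0) | lia].
have ab0 : a + b != 0.
  apply/eqP => ab; apply: nlt; have := vgeN hb.
  by have -> : - b = a by rewrite -[RHS](addrK b) ab sub0r.
split=> //; apply/eqP; rewrite eq_le; apply/andP; split.
  rewrite leNgt; apply/negP => lt; apply: nlt.
  have : vge P (val P a + 1) (a + b) by right; lia.
  by move=> /vgeB/(_ hb); rewrite addrK.
have ha : vge P (val P a) a by right.
have hb' : vge P (val P a) b by apply: vge_le hb; lia.
by case: (vgeD ha hb') => [/eqP|//]; rewrite (negPf ab0).
Qed.

(** A discrete valuation ring is a maximal proper subring: if z in a larger ring has negative order
    at P, then y = z^n (y / z^n) with n = |v(y)| has its second factor in the smaller ring, so the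
    larger one is all of F. *)
Lemma vring_incomparable P P' : P != P' ->
  exists2 z, z \in vring P & z \notin vring P'.
Proof.
move=> PP'; apply: contrapT => nz.
have sub z : z \in vring P -> z \in vring P'.
  by move=> zO; apply: contrapT => /negP zO'; apply: nz; exists z.
case/eqP: PP'; apply: place_ext => z; apply/idP/idP; first exact: sub.
move=> zO'; apply: contrapT => /negP zO.
have z0 : z != 0 by apply: contraNneq zO => ->; rewrite rpred0.
have [y yO'] := vring_proper P'.
have y0 : y != 0 by apply: contraNneq yO' => ->; rewrite rpred0.
have vz : val P z < 0 by move: zO; rewrite vring_valuation // ltNge.
case/negP: yO'.
pose n := `|val P y|%N.
have -> : y = z ^+ n * (y / z ^+ n) by rewrite mulrC divfK // expf_neq0.
rewrite rpredM ?rpredX // sub // vring_valuation ?mulf_neq0 ?invr_eq0 ?expf_neq0 //.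
rewrite valuationM ?invr_eq0 ?expf_neq0 // valuationV valuationX.
by have := mulrn_lt0_le n vz; rewrite /n; lia.
Qed.

Lemma vringX_notin P (z : F) k : z \notin vring P -> z ^+ k.+1 \notin vring P.
Proof.
move=> zO; have z0 : z != 0 by apply: contraNneq zO => ->; rewrite rpred0.
move: zO; rewrite !vring_valuation ?expf_neq0 // valuationX -!ltNge => vz.
by have := mulrn_lt0_le k.+1 vz; lia.
Qed.

Lemma separating_element P s : P \notin s ->
  exists2 u, u \in videal P & forall P', P' \in s -> u \notin vring P'.
Proof.
elim: s => [|P' s IHs]; first by exists 0; rewrite ?videal0.
rewrite inE negb_or => /andP[PP' Ps]; have [u uP uN] := IHs Ps.
have [uO'|uO'] := boolP (u \in vring P'); last first.
  by exists u => // Q; rewrite inE => /orP[/eqP->|/uN].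
have [a aO aO'] := vring_incomparable PP'.
have [|b bO' bO] := @vring_incomparable P' P; first by rewrite eq_sym.
have b0 : b != 0 by apply: contraNneq bO => ->; rewrite rpred0.
have a0 : a != 0 by apply: contraNneq aO' => ->; rewrite rpred0.
have zP : a / b \in videal P by rewrite videalMl // videalE invrK bO orbT.
have zO' : a / b \notin vring P'.
  have : b / a \in videal P' by rewrite videalMl // videalE invrK aO' orbT.
  by rewrite videalE invf_div mulf_eq0 invr_eq0 (negPf a0) (negPf b0).
set z := a / b in zP zO'.
have z0 : z != 0 by rewrite mulf_neq0 ?invr_eq0.
(* With this exponent z^(r + 1) has a strictly worse pole than u at every Q in s where z has a pole,
   so the sum below keeps a pole at each Q. *)
pose r := (\sum_(Q <- s) `|val Q u|)%N.
exists (u + z ^+ r.+1).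
  by rewrite videalD // exprS videalMr // rpredX // videal_vring.
have addN (Q : place iota) c d : c \in vring Q -> d \notin vring Q -> c + d \notin vring Q.
  by move=> cO; apply: contra => h; rewrite -(addKr c d) rpredD ?rpredN.
move=> Q; rewrite inE => /orP[/eqP->|Qs]; first exact/addN/vringX_notin.
have uQ := uN Q Qs.
have [zQ|zQ] := boolP (z \in vring Q).
  by rewrite addrC addN // rpredX.
have u0 : u != 0 by apply: contraNneq uQ => ->; rewrite rpred0.
have ler : (`|val Q u| <= r)%N by rewrite /r (big_rem Q) //= leq_addr.
rewrite addrC; have [||uz0 vuz] := @valuationD_lt Q (z ^+ r.+1) u.
- by rewrite expf_neq0.
- right; rewrite valuationX; move: zQ; rewrite vring_valuation // -ltNge => vz.
  exact: mulrn_lt0_dominated.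
- rewrite vring_valuation // vuz -vring_valuation ?expf_neq0 //; exact: vringX_notin.
Qed.

(** 1 / (1 + u^(N + 1)) is close to 1 at P, where u vanishes, and close to 0 at the poles of u. *)
Lemma approx_one P s (N : nat) : P \notin s ->
  exists2 e, e - 1 \in videal P & forall P', P' \in s -> vge P' N e.
Proof.
move=> /separating_element[u uP uN]; pose w := u ^+ N.+1.
have wP : w \in videal P by rewrite /w exprS videalMr // rpredX // videal_vring.
have wU : 1 + w \in vunit P by rewrite vunitD // vunit1.
have /vunitP[w0 _ wVO] := wU.
exists (1 + w)^-1.
  have -> : (1 + w)^-1 - 1 = - w / (1 + w).
    by apply: (mulIf w0); rewrite mulrBl divfK // mulVf // mul1r opprD addrA subrr sub0r.
  by rewrite videalMr // videalN.
move=> Q /uN uQ; right.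
have u0 : u != 0 by apply: contraNneq uQ => ->; rewrite rpred0.
have vu : val Q w <= - N%:Z - 1.
  move: uQ; rewrite vring_valuation // -ltNge valuationX => vu.
  by have := mulrn_lt0_le N.+1 vu; lia.
rewrite valuationV addrC; have [||_ ->] := @valuationD_lt Q w 1.
- by rewrite expf_neq0.
- by right; rewrite valuation1; lia.
- by lia.
Qed.

End Valuations.

(** * Riemann-Roch spaces over sets of places *)

Section RiemannRoch.
Variables (K F : fieldType) (iota : {rmorphism K -> F}).
Implicit Types (P : place iota) (s : seq (place iota)) (D : place iota -> int).
Implicit Types (T : set (place iota)).

Hypothesis discrete : forall P, exists t, uniformizer P t.
Hypothesis residue_fin : forall P,
  exists n, has_dim iota [set` vring P] [set` videal P] n.

Local Notation val := valuation.
Local Notation vgeD := (vgeD discrete).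
Local Notation vgeM := (vgeM discrete).

(** For finite [T] the quotients of these spaces are computed exactly by weak approximation; for [T]
    the set of all places one gets L(D), whose quotients embed into the former. *)
Definition rr T D : set F := [set z | forall P, T P -> vge P (- D P) z].

Lemma RR_spaceE D : RR_space D = rr setT D.
Proof.
apply/seteqP; split=> z.
  by case=> [-> P _|h P _]; [left | right].
move=> h; have [->|z0] := eqVneq z 0; [by left | right => P].
by case: (h P I) => // /eqP; rewrite (negPf z0).
Qed.

Lemma rr_subspace T D : subspace iota (rr T D).
Proof.
split=> [P _|c a b ha hb P TP]; first by left.
apply: vgeD; last exact: hb.
by rewrite -[- D P]add0r; apply: vgeM; [apply: vge_const | apply: ha].
Qed.

Lemma subspace0 : subspace iota [set 0].
Proof. by split=> // c a b /= -> ->; rewrite mulr0 addr0. Qed.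

Lemma place_degP P : has_dim iota [set` vring P] [set` videal P] (place_deg P).
Proof.
have [n hn] := residue_fin P; rewrite /place_deg (dim_modE _ hn) //.
exact: videal_subspace.
Qed.

Lemma place_deg_gt0 P : (0 < place_deg P)%N.
Proof.
rewrite lt0n; apply/eqP => d0; have := place_degP P; rewrite d0.
case=> b [_ _ gen]; have [|c] := gen 1; first exact: rpred1.
rewrite big_ord0 subr0 /= => h; have := videalNunit h.
by rewrite vunit1.
Qed.

(** Multiplication by an element g of order D P + 1 at P, followed by reduction at P, identifies the
    quotient with the residue field; surjectivity is weak approximation. *)
Lemma rr_step P s D : P \in s ->
  has_dim iota (rr [set` s] (fun Q => D Q + (Q == P)%:Z)) (rr [set` s] D)
    (place_deg P).
Proof.
move=> Ps; have [t ut] := discrete P; have [t0 _ _] := ut.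
pose g := t ^ (D P + 1); have g0 : g != 0 by rewrite expfz_neq0.
have vg : val P g = D P + 1.
  by rewrite valuationXz // (valuation_uniformizer ut) -mulrzr mul1r /= intz.
have vgeg : vge P (D P + 1) g by right; rewrite vg.
have vgeV : vge P (- (D P + 1)) g^-1 by right; rewrite valuationV // vg.
apply: (has_dim_mul (videal_subspace P) _ _ _ _ (rr_subspace _ _) (place_degP P)
  (g := g)).
- move=> z /(_ P Ps) hz; apply/(vge_vring discrete).
  have := vgeM vgeg hz; congr (vge P _ _); rewrite eqxx; clear; lia.
- move=> z /(_ P Ps) hz; apply/(vge_videal discrete).
  have := vgeM vgeg hz; congr (vge P _ _); clear; lia.
- move=> z zU /(vge_videal discrete) gz Q Qs.
  have [->|QP] := eqVneq Q P; last by have := zU Q Qs; rewrite (negPf QP) addr0.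
  have := vgeM vgeV gz; rewrite mulKf //; congr (vge P _ _); clear; lia.
- move=> w /= wO.
  have [->|w0] := eqVneq w 0.
    by exists 0; rewrite ?mulr0 ?subr0 ?videal0 // => Q _; left.
  pose s' := [seq Q <- s | Q != P].
  (* Large enough for e (w / g) to meet the condition at every other Q in s. *)
  pose N := (\sum_(Q <- s) (`|D Q| + `|val Q (w / g)|))%N.
  have Ps' : P \notin s' by rewrite mem_filter eqxx.
  have [e eP eN] := approx_one discrete N Ps'.
  have eO : e \in vring P by rewrite -(subrK 1 e) rpredD ?rpred1 ?videal_vring.
  exists (e * (w / g)); last first.
    have -> : w - g * (e * (w / g)) = - (e - 1) * w.
      by rewrite mulrCA [g * _]mulrC divfK // opprB mulrBl mul1r.
    by rewrite videalMr // videalN.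
  move=> Q Qs; have [->|QP] := eqVneq Q P.
    rewrite -[- _]add0r; apply: vgeM; first exact/(vge_vring discrete).
    rewrite -[- _]add0r; apply: vgeM => //.
    exact/(vge_vring discrete).
  rewrite addr0; have Qs' : Q \in s' by rewrite mem_filter QP.
  have hwg : vge Q (val Q (w / g)) (w / g) by right.
  have leN : (`|D Q| + `|val Q (w / g)| <= N)%N by rewrite /N (big_rem Q) //= leq_addr.
  apply: (vge_le _ (vgeM (eN Q Qs') hwg)).
  by move: leN; clear; lia.
Qed.

Lemma rr_dim s D D' : uniq s -> (forall P, P \in s -> D P <= D' P) ->
  has_dim iota (rr [set` s] D') (rr [set` s] D)
    (\sum_(P <- s) `|D' P - D P| * place_deg P)%N.
Proof.
move=> us; have [n] := ubnP (\sum_(P <- s) `|D' P - D P|)%N.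
elim: n D' => // n IHn D' ltn leD.
have [eqD|neqD] := EM (forall P, P \in s -> D P = D' P).
  rewrite big_seq big1 => [|P Ps]; last by rewrite eqD // subrr.
  have -> : rr [set` s] D' = rr [set` s] D.
    by apply/seteqP; split=> z h P Ps; have := h P Ps; rewrite eqD.
  by apply: has_dim0 => P _; left.
have [P Ps ltP] : exists2 P, P \in s & D P < D' P.
  apply: contrapT => no; apply: neqD => P Ps; apply/eqP; rewrite eq_le leD //=.
  by rewrite leNgt; apply/negP => lt; apply: no; exists P.
pose D1 Q := D' Q - (Q == P)%:Z.
have leD1 Q : Q \in s -> D Q <= D1 Q.
  move=> Qs; rewrite /D1; have [->|_] := eqVneq Q P; last by rewrite subr0 leD.
  by move: ltP; clear; lia.
have sumE (f : place iota -> nat) :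
    (\sum_(Q <- s) `|D' Q - D Q| * f Q = f P + \sum_(Q <- s) `|D1 Q - D Q| * f Q)%N.
  rewrite (big_rem P Ps) [X in _ = (_ + X)%N](big_rem P Ps) /= addnA; congr (_ + _)%N.
    by rewrite /D1 eqxx -mulSn; congr (_ * _)%N; move: ltP; clear; lia.
  rewrite [RHS]big_seq [LHS]big_seq; apply: eq_bigr => Q.
  by rewrite mem_rem_uniq // inE => /andP[QP _]; rewrite /D1 (negPf QP) subr0.
have D1E : (fun Q => D1 Q + (Q == P)%:Z) = D'.
  by apply/funext => Q; rewrite subrK.
rewrite sumE; apply: (@has_dim_add _ _ _ _ (rr [set` s] D1)).
- exact: rr_subspace.
- exact: rr_subspace.
- exact: rr_subspace.
- move=> z h Q Qs; apply: vge_le (h Q Qs).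
  by rewrite /D1; case: (_ == _); lia.
- by move=> z h Q Qs; apply: vge_le (h Q Qs); have := leD1 Q Qs; lia.
- by rewrite -{1}D1E; apply: rr_step.
- apply: IHn => //; move: ltn.
  have := sumE (fun=> 1%N); rewrite -!big_distrl /= !muln1 => ->.
  by rewrite add1n ltnS.
Qed.

(** The conditions outside s agree, so L(D') / L(D) embeds into the corresponding quotient over s;
    no surjectivity is claimed, whence the inequality. *)
Lemma rr_dim_mono s D D' n : uniq s -> (forall P, D P <= D' P) ->
  (forall P, P \notin s -> D P = D' P) -> has_dim iota (rr setT D') [set 0] n ->
  exists2 k, has_dim iota (rr setT D) [set 0] k &
    (n <= k + \sum_(P <- s) `|D' P - D P| * place_deg P)%N.
Proof.
move=> us leD eqD hn.
have subD : rr setT D `<=` rr setT D'.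
  by move=> z h P _; apply: vge_le (h P I); rewrite lerN2.
have [k _ hk] := has_dim_inj subspace0 subspace0 (rr_subspace setT D) subD
  (fun z _ h => h) hn.
have [//|l lel hl] := has_dim_inj (rr_subspace setT D) (rr_subspace [set` s] D)
  (rr_subspace setT D') (fun z h P _ => h P I) _ (rr_dim us (fun P _ => leD P)).
  move=> z zD' zD P _; have [Ps|Ps] := boolP (P \in s); first exact: zD.
  by rewrite eqD //; apply: zD'.
exists k => //; suff -> : n = (l + k)%N by rewrite addnC leq_add2l.
apply: (has_dim_uniq subspace0 hn); apply: (has_dim_add _ _ _ subD _ hl hk).
- exact: rr_subspace.
- exact: rr_subspace.
- exact: subspace0.
- by move=> _ -> P _; left.
Qed.

(* Fundamental inequality: the zeros of h(Y) have total degree at most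
   [F : K(h(Y))] = 2 deg h. *)
Lemma zeros_degree_le Y X (h : {poly K}) d s D : transcendental iota Y ->
  gen2 iota Y X -> h != 0 -> size h = d.+1 -> uniq s ->
  (forall P, P \in s -> [/\ Y \in vring P, 0 <= D P & vge P (D P) (ev iota Y h)]) ->
  (\sum_(P <- s) `|D P| * place_deg P <= d.*2)%N.
Proof.
move=> trY genY h0 szh us hs.
(* [b] is a basis of the functions regular on s modulo those vanishing to order D. With more than 2
   d elements, a nontrivial combination would be a multiple of h(Y) and so vanish to order D. *)
have [|b [Ub ib _]] := @rr_dim s (fun P => - D P) (fun=> 0) us.
  by move=> P /hs[_ h' _]; rewrite oppr_le0.
have sumE : (\sum_(P <- s) `|0 - - D P| * place_deg P =
             \sum_(P <- s) `|D P| * place_deg P)%N.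
  by apply: eq_bigr => P _; rewrite sub0r opprK.
rewrite sumE in b Ub ib *; rewrite leqNgt; apply/negP => lt.
have rr0 z : rr [set` s] (fun=> 0) z <-> forall P, P \in s -> z \in vring P.
  by split=> hz P Ps; [apply/(vge_vring discrete) | rewrite oppr0;
    apply/(vge_vring discrete)]; have := hz P Ps; rewrite ?oppr0.
have [||||c [[i ci] [a aA cE]]] := @relation_mod _ _ iota Y X trY genY
    (rr [set` s] (fun=> 0)) h d _ b _ _ _ _ h0 szh lt.
- split; first by apply/rr0 => P _; rewrite rpred1.
    by move=> u v /rr0 hu /rr0 hv; apply/rr0 => P Ps; rewrite rpredB ?hu ?hv.
  by move=> u v /rr0 hu /rr0 hv; apply/rr0 => P Ps; rewrite rpredM ?hu ?hv.
- by move=> u; apply/rr0 => P _; rewrite vring_const.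
- by apply/rr0 => P /hs[YO _ _]; apply: ev_vring.
- exact: Ub.
move: ci; rewrite (ib c) ?eqxx //= => P Ps; rewrite opprK -/(comb _ _ _) cE.
rewrite -[D P]addr0; have [_ _ fD] := hs P Ps.
by apply: vgeM => //; have := aA P Ps; rewrite oppr0.
Qed.

Lemma zeros_finite Y X (h : {poly K}) : transcendental iota Y ->
  gen2 iota Y X -> h != 0 ->
  finite_set [set P : place iota | Y \in vring P /\ ev iota Y h \in videal P].
Proof.
move=> trY genY h0; apply: contrapT => /infinite_set_fset.
have szh : size h = (size h).-1.+1 by rewrite prednK // size_poly_gt0.
move=> /(_ (size h).-1.*2.+1)[B BZ]; apply/negP; rewrite -ltnNge ltnS.
have := @zeros_degree_le Y X h _ (finmap.enum_fset B) (fun=> 1) trY genY h0 szh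
  (finmap.fset_uniq B).
move=> H; apply: leq_trans (H _) => [|P PB]; last first.
  have [YO hP] := BZ P PB; split=> //; exact/(vge_videal discrete).
rewrite -sum1_size; apply: leq_sum => P _.
by rewrite mul1n place_deg_gt0.
Qed.

End RiemannRoch.

(** * The order K[y] + K[y] x, with x^2 = A x - c *)

Section QuadraticOrder.
Variables (K : fieldType) (A : {poly K}) (c : K).
Implicit Types (p : {poly K}) (r s : {poly K} * {poly K}).
Hypotheses (A' : A^`() = 1) (c0 : c != 0).
Let PK : comNzRingType := {poly K}.
Add Ring polyK_ring : (ring_theory_of PK).

(** Pairs stand for a + b x but stay formal, since divisibility by p concerns the two polynomials.
    With x + x' = A and x x' = c, [qnorm] is the product and [qtrace] the sum of a + b x and a + b
    x'. *)
Definition qmul r s : {poly K} * {poly K} :=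
  (r.1 * s.1 - c%:P * (r.2 * s.2), r.1 * s.2 + r.2 * s.1 + A * (r.2 * s.2)).
Definition qnorm r : {poly K} :=
  r.1 * r.1 + r.1 * r.2 * A + c%:P * (r.2 * r.2).
Definition qtrace r : {poly K} := r.1 + r.1 + r.2 * A.
Definition qexp r n := iter n (qmul r) (1, 0).

Lemma qnormM r s : qnorm (qmul r s) = qnorm r * qnorm s.
Proof.
case: r s => [a b] [a' b']; rewrite /qnorm /qmul /=.
set C := c%:P; by cring PK.
Qed.

Lemma qnormX r n : qnorm (qexp r n) = qnorm r ^+ n.
Proof.
elim: n => [|n IHn]; last by rewrite /= qnormM IHn exprS.
by rewrite /qnorm /= !(mulr0, mul0r, addr0, mulr1).
Qed.

Lemma irreducible_divisor (D : {poly K}) : (1 < size D)%N ->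
  exists2 p, irreducible_poly p & p %| D.
Proof.
move=> szD.
pose P n := `[< exists2 p, (p %| D) && (1 < size p)%N & size p = n >].
have [|n /asboolP[p /andP[pD szp] <-] minp] := ex_minnP (P := P).
  by exists (size D); apply/asboolP; exists D; rewrite ?dvdpp.
exists p => //; split=> // q szq qp.
have p0 : p != 0 by rewrite -size_poly_gt0 (ltn_trans _ szp).
have q0 : q != 0 by apply: contraNneq p0 => q0; move: qp; rewrite q0 dvd0p.
rewrite -dvdp_size_eqp // eqn_leq dvdp_leq // minp //.
apply/asboolP; exists q; rewrite // (dvdp_trans qp pD) ltn_neqAle eq_sym szq.
by rewrite size_poly_gt0.
Qed.

Lemma irreducible_prime p a b : irreducible_poly p -> p %| a * b ->
  (p %| a) || (p %| b).
Proof.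
move=> irr; case: (boolP (p %| a)) => //= pa.
by rewrite mulrC Gauss_dvdpl // irreducible_poly_coprime.
Qed.

Lemma irreducible_primeX p a n : irreducible_poly p -> p %| a ^+ n -> p %| a.
Proof.
move=> irr; elim: n => [|n IHn].
  rewrite expr0 dvdp1 => /eqP sz1; case: irr => lt1 _; move: lt1.
  by rewrite sz1.
by rewrite exprS => /(irreducible_prime irr)/orP[].
Qed.

(* The hypothesis on powers says that r / p is almost integral. *)
Lemma qorder_norm_trace p r k : irreducible_poly p ->
  ~~ ((p %| r.1) && (p %| r.2)) ->
  (forall n, exists s, p ^+ k * (qexp r n).1 = p ^+ n * s.1 /\
                       p ^+ k * (qexp r n).2 = p ^+ n * s.2) ->
  p %| qtrace r /\ p ^+ 2 %| qnorm r.
Proof.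
move=> irr ndiv pow; have p0 := irredp_neq0 irr.
have pX n : p ^+ n != 0 by rewrite expf_neq0.
have normdiv : p ^+ 2 %| qnorm r.
  have [s [e1 e2]] := pow (k.*2.+1).
  have : p ^+ k.*2 * qnorm r ^+ k.*2.+1 = p ^+ (k.*2.+1).*2 * qnorm s.
    rewrite -qnormX -!muln2 !exprM !expr2 /qnorm.
    transitivity ((p ^+ k * (qexp r k.*2.+1).1) * (p ^+ k * (qexp r k.*2.+1).1) +
      (p ^+ k * (qexp r k.*2.+1).1) * (p ^+ k * (qexp r k.*2.+1).2) * A +
      c%:P * ((p ^+ k * (qexp r k.*2.+1).2) * (p ^+ k * (qexp r k.*2.+1).2))).
      by rewrite !muln2; set C := c%:P; cring PK.
    by rewrite e1 e2 muln2; set C := c%:P; cring PK.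
  have -> : ((k.*2.+1).*2 = k.*2 + k.*2.+2)%N by lia.
  rewrite exprD -mulrA => /(mulfI (pX _)) e.
  have pn : p %| qnorm r.
    apply: (@irreducible_primeX _ _ k.*2.+1 irr).
    by rewrite e exprS -mulrA dvdp_mulr.
  have [n1 nE] := dvdpP _ _ pn; rewrite mulrC in nE.
  rewrite nE expr2 dvdp_mul2l //; move: e.
  rewrite nE exprMn [p ^+ k.*2.+2]exprSr -mulrA => /(mulfI (pX _)) e.
  by apply: (@irreducible_primeX _ _ k.*2.+1 irr); rewrite e dvdp_mulr.
split=> //; apply: contraT => ntr; case/negP: ndiv.
have pn : p %| qnorm r by apply: dvdp_trans normdiv; rewrite expr2 dvdp_mulr.
have dvB a b : p %| a - b -> p %| a -> p %| b.
  by move=> h1 h2; rewrite -(subKr a b) dvdp_sub.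
(* Modulo p the norm is zero, so r^(n+1) = T^n r with T the trace. As p divides r^(k+1), it would
   divide r if it did not divide T. *)
have step n : (p %| qtrace r ^+ n * r.1 - (qexp r n.+1).1) &&
              (p %| qtrace r ^+ n * r.2 - (qexp r n.+1).2).
  elim: n => [|n /andP[IH1 IH2]].
    by rewrite /= !(expr0, mulr0, mulr1, mul1r, addr0, add0r, subr0) !subrr dvdp0.
  rewrite [qexp r n.+2]/(qmul r (qexp r n.+1)).
  move: IH1 IH2; set T := qtrace r ^+ n; rewrite exprS -/T.
  set s := qexp r n.+1 => IH1 IH2; apply/andP; split.
    have -> : qtrace r * T * r.1 - (qmul r s).1 =
      T * qnorm r + r.1 * (T * r.1 - s.1) - c%:P * r.2 * (T * r.2 - s.2).
      by rewrite /qtrace /qnorm /qmul /=; set C := c%:P; cring PK.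
    by rewrite dvdp_sub ?dvdp_add ?dvdp_mull.
  have -> : qtrace r * T * r.2 - (qmul r s).2 =
      r.1 * (T * r.2 - s.2) + r.2 * (T * r.1 - s.1) + A * r.2 * (T * r.2 - s.2).
    by rewrite /qtrace /qmul /=; cring PK.
  by rewrite !dvdp_add ?dvdp_mull.
have [s []] := pow k.+1; rewrite exprSr -!mulrA => /(mulfI (pX _)) e1.
move=> /(mulfI (pX _)) e2; have /andP[s1 s2] := step k.
have d1 : p %| (qexp r k.+1).1 by rewrite e1 dvdp_mulr.
have d2 : p %| (qexp r k.+1).2 by rewrite e2 dvdp_mulr.
have fin t : p %| qtrace r ^+ k * t -> p %| t.
  move/(irreducible_prime irr)/orP => [/(irreducible_primeX irr)|//].
  by rewrite (negPf ntr).
apply/andP; split; apply: fin.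
  by rewrite -(subrK (qexp r k.+1).1 (_ * _)) dvdp_add.
by rewrite -(subrK (qexp r k.+1).2 (_ * _)) dvdp_add.
Qed.

(* Differentiating the norm form, with A' = 1, shows smoothness modulo p. *)
Lemma qorder_smooth p r : irreducible_poly p ->
  p %| qtrace r -> p ^+ 2 %| qnorm r -> (p %| r.1) && (p %| r.2).
Proof.
move=> irr ptr p2n; have pn : p %| qnorm r.
  by apply: dvdp_trans p2n; rewrite expr2 dvdp_mulr.
have pdn : p %| (qnorm r)^`().
  have [n1 ->] := dvdpP _ _ p2n.
  rewrite expr2 !derivM; apply: dvdp_add; first by rewrite !dvdp_mull.
  by apply: dvdp_mull; apply: dvdp_add; [apply: dvdp_mull | apply: dvdp_mulr].
have pC t : p %| c%:P * t -> p %| t by rewrite mul_polyC dvdpZr.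
case: r {p2n} => [a b] /= in ptr pn pdn *; set C := c%:P in pC.
rewrite /qtrace /= in ptr; rewrite /qnorm /= -/C in pn pdn.
have b_a : p %| b -> p %| a.
  move=> pb; have : p %| a * a.
    have -> : a * a = a * a + a * b * A + C * (b * b) - (a * A + C * b) * b.
      by cring PK.
    by rewrite dvdp_sub // dvdp_mull.
  by move/(irreducible_prime irr)/orP => [].
have [pb|pb] := boolP (p %| b); first by rewrite b_a.
(* The trace is the partial derivative of the norm in a, and a A + 2 c b the one in b; Euler's
   identity for the quadratic form yields the second from the first. *)
have paCb : p %| a * A + (C + C) * b.
  have : p %| b * (a * A + (C + C) * b).
    have -> : b * (a * A + (C + C) * b) =
      (a * a + a * b * A + C * (b * b)) + (a * a + a * b * A + C * (b * b))
       - a * (a + a + b * A) by cring PK.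
    by rewrite dvdp_sub ?(dvdp_add pn pn) // dvdp_mull.
  by move/(irreducible_prime irr)/orP => [|//]; rewrite (negPf pb).
(* By the chain rule the y-derivative of the norm is a' N_a + b' N_b + a b A', where A' = 1. *)
have : p %| a * b.
  have -> : a * b = (a * a + a * b * A + C * (b * b))^`() -
      a^`() * (a + a + b * A) - b^`() * (a * A + (C + C) * b).
    rewrite !derivD !derivM A' derivC mulr1.
    by cring PK.
  by rewrite !dvdp_sub // dvdp_mull.
move=> /(irreducible_prime irr); rewrite (negPf pb) orbF => pa.
suff : p %| b by rewrite (negPf pb).
have : p %| C * (b * b).
  have -> : C * (b * b) = a * a + a * b * A + C * (b * b) - (a + b * A) * a.
    by cring PK.
  by rewrite dvdp_sub // dvdp_mull.
by move/pC/(irreducible_prime irr)/orP => [].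
Qed.

End QuadraticOrder.

(** * The curve x + c / x = A(y) *)

Section Inversion.
Variables (K F : fieldType) (iota : {rmorphism K -> F}).
Local Notation ev := (ev iota).

Lemma transcendentalV Y : transcendental iota Y -> transcendental iota Y^-1.
Proof. by move=> trY /algebraic_inv; rewrite invrK. Qed.

Lemma transcendental_neq0 Y : transcendental iota Y -> Y != 0.
Proof. by move=> trY; apply/eqP => Y0; apply: trY; rewrite Y0; apply: algebraic0. Qed.

Lemma ev_inv Y k (p : {poly K}) : Y != 0 -> (size p <= k.+1)%N ->
  ev Y p = Y ^+ k * ev Y^-1 (\poly_(i < k.+1) p`_(k - i)).
Proof.
move=> Y0 szp; rewrite /ev (@horner_coef_wide _ k.+1) ?size_map_poly //.
rewrite (@horner_coef_wide _ k.+1) ?size_map_poly ?size_poly //.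
rewrite mulr_sumr (reindex_inj rev_ord_inj) /=; apply: eq_bigr => i _.
rewrite !coef_map coef_poly ltn_ord subSS mulrCA; congr (_ * _).
have le_ik : (i <= k)%N by rewrite -ltnS.
have -> : Y ^+ k = Y ^+ (k - i) * Y ^+ i by rewrite -exprD subnK.
by rewrite exprVn mulfK // expf_neq0.
Qed.

Lemma gen2V Y X : Y != 0 -> gen2 iota Y X -> gen2 iota Y^-1 X.
Proof.
move=> Y0 genY z; have [D [a [b [D0 e]]]] := genY z.
pose k := (size D + size a + size b)%N.
pose rv (p : {poly K}) := \poly_(i < k.+1) p`_(k - i).
have [szD sza szb] : [/\ size D <= k.+1, size a <= k.+1 & size b <= k.+1]%N.
  by rewrite /k; split; lia.
exists (rv D), (rv a), (rv b); split.
  apply: contra_neq D0 => /polyP rv0; apply/polyP => i; rewrite coef0.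
  have [lik|ltki] := leqP i k; last by rewrite nth_default // (leq_trans szD).
  have := rv0 (k - i)%N; rewrite coef_poly coef0 subKn // ltnS leq_subr.
  by [].
have Yk0 : Y ^+ k != 0 by rewrite expf_neq0.
apply: (mulfI Yk0); rewrite mulrDr !mulrA -!ev_inv //.
Qed.

End Inversion.

Section Curve.
Variables (K F : fieldType) (iota : {rmorphism K -> F}).
Variables (x y : F) (A : {poly K}) (c : K) (m : nat).
Hypotheses (A' : A^`() = 1) (szA : size A = m.+1) (m_gt0 : (0 < m)%N).
Hypotheses (c0 : c != 0) (trx : transcendental iota x).
Hypothesis gen : adjoin iota [set x; y] = [set: F].
Hypothesis curve_eq : x + iota c / x = ev iota y A.
Local Notation ev := (ev iota).
Local Notation val := valuation.
Add Ring F_ring : (ring_theory_of F).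

(** * F as a quadratic extension of K(y) *)

Lemma x_neq0 : x != 0. Proof. exact: transcendental_neq0 trx. Qed.

Lemma curve_sqr : x * x = ev y A * x - iota c.
Proof. by rewrite -curve_eq mulrDl divfK ?x_neq0 // addrK. Qed.

(** Otherwise A(y) would be algebraic, and with it x, a root of X^2 - A(y) X + c. *)
Lemma y_transcendental : transcendental iota y.
Proof.
move=> algy; apply: trx.
have algA : algebraicOver iota (ev y A).
  rewrite evE; apply: (big_ind (algebraicOver iota)); first exact: algebraic0.
    exact: algebraic_add.
  move=> i _; apply: algebraic_mul; first exact: algebraic_id.
  elim: (nat_of_ord i) => [|k IHk]; first by rewrite expr0; apply: algebraic1.
  by rewrite exprS; apply: algebraic_mul.
pose q : {poly F} := 'X^2 - (ev y A *: 'X - (iota c)%:P).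
have szq : size q = 3.
  rewrite /q size_polyDl size_polyXn // size_polyN.
  rewrite (leq_ltn_trans (size_polyD _ _)) // size_polyN gtn_max.
  rewrite (leq_ltn_trans (size_scale_leq _ _)) ?size_polyX //.
  by rewrite (leq_ltn_trans (size_polyC_leq1 _)).
apply/integral_algebraic/(@integral_root _ _ _ q).
- by rewrite -size_poly_gt0 szq.
- by rewrite rootE /q !hornerE expr2 curve_sqr subrr.
- move=> d /(nthP 0)[i _ <-]; apply/integral_algebraic.
  rewrite /q !coefE; apply: algebraic_sub.
    by case: eqP => _; [exact: algebraic1 | exact: algebraic0].
  apply: algebraic_sub.
    apply: algebraic_mul => //.
    by case: eqP => _; [exact: algebraic1 | exact: algebraic0].
  by case: eqP => _; [exact: algebraic_id | exact: algebraic0].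
Qed.

(** The elements (a + b x) / D form a subfield containing x and y; an inverse comes from the
    conjugate, since r (T - r) = N for the trace T and the norm N of r. *)
Lemma curve_gen2 : gen2 iota y x.
Proof.
pose L : {pred F} := fun z =>
  `[< exists D a b, D != 0 /\ ev y D * z = ev y a + ev y b * x >].
have LP z : reflect
  (exists D a b, D != 0 /\ ev y D * z = ev y a + ev y b * x) (z \in L).
  exact: asboolP.
have evN0 D : D != 0 -> ev y D != 0 by rewrite ev_eq0 //; apply: y_transcendental.
have L1 : 1 \in L.
  by apply/LP; exists 1, 1, 0; rewrite oner_neq0 ev1 ev0 mul0r addr0 mul1r.
have LB : {in L &, forall u v, u - v \in L}.
  move=> u v /LP[D [a [b [D0 e]]]] /LP[D2 [a2 [b2 [D20 e2]]]]; apply/LP.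
  exists (D * D2), (D2 * a - D * a2), (D2 * b - D * b2); split.
    by rewrite mulf_neq0.
  rewrite !evB !evM.
  transitivity (ev y D2 * (ev y D * u) - ev y D * (ev y D2 * v)); first by cring F.
  by rewrite e e2; cring F.
have LM u v : u \in L -> v \in L -> u * v \in L.
  move=> /LP[D [a [b [D0 e]]]] /LP[D2 [a2 [b2 [D20 e2]]]]; apply/LP.
  exists (D * D2), (a * a2 - c%:P * (b * b2)), (a * b2 + a2 * b + A * (b * b2)).
  split; first by rewrite mulf_neq0.
  rewrite !(evB, evD, evM) evC.
  transitivity ((ev y D * u) * (ev y D2 * v)); first by cring F.
  rewrite e e2.
  transitivity (ev y a * ev y a2 + (ev y a * ev y b2 + ev y a2 * ev y b) * x +
    ev y b * ev y b2 * (x * x)); first by cring F.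
  by rewrite curve_sqr; cring F.
have Lev p : ev y p \in L.
  by apply/LP; exists 1, p, 0; rewrite oner_neq0 ev1 ev0 mul0r addr0 mul1r.
have LVev p : (ev y p)^-1 \in L.
  have [->|p0] := eqVneq p 0; first by rewrite ev0 invr0 -(ev0 iota y).
  by apply/LP; exists p, 1, 0; rewrite ev1 ev0 mul0r addr0 divff // evN0.
have LV u : u \in L -> u^-1 \in L.
  move=> uL; have /LP[D [a [b [D0 e]]]] := uL.
  have [->|u0] := eqVneq u 0; first by rewrite invr0 -(subrr 1) LB.
  pose r := ev y a + ev y b * x.
  have r0 : r != 0 by rewrite /r -e mulf_neq0 ?evN0.
  have -> : u^-1 = ev y D * r^-1 by rewrite /r -e invfM mulrA divff ?mul1r // evN0.
  apply: (LM) => //.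
  have rr : r * r = ev y (qtrace A (a, b)) * r - ev y (qnorm A c (a, b)).
    rewrite /qtrace /qnorm /= !(evD, evM) evC.
    transitivity (ev y a * ev y a + (ev y a * ev y b + ev y a * ev y b) * x +
      ev y b * ev y b * (x * x)); first by rewrite /r; cring F.
    by rewrite curve_sqr /r; cring F.
  (* The independence of 1 and x over K(y) is only proved later; if the norm vanishes, r equals its
     trace and is in K(y). *)
  have [n0|n0] := eqVneq (qnorm A c (a, b)) 0.
    have rE : r = ev y (qtrace A (a, b)).
      by apply: (mulIf r0); rewrite rr n0 ev0 subr0.
    by rewrite rE.
  have -> : r^-1 = (ev y (qtrace A (a, b)) - r) * (ev y (qnorm A c (a, b)))^-1.
    apply: (mulIf (evN0 _ n0)); rewrite divfK ?evN0 //.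
    apply: (mulfI r0); rewrite mulrA divff // mul1r mulrBr rr.
    by rewrite [r * _]mulrC opprB addrC subrK.
  apply: (LM) => //; apply: LB => //.
  by apply/LP; exists 1, a, b; rewrite oner_neq0 ev1 mul1r.
have divL : divring_closed L.
  by split=> // u v uL vL; rewrite LM // LV.
move=> z; apply/LP.
have : adjoin iota [set x; y] z by rewrite gen.
apply=> // [k|w /= [->|->]]; first by rewrite -(evC iota y) Lev.
  by apply/LP; exists 1, 0, 1; rewrite oner_neq0 ev1 ev0 mul1r add0r.
by rewrite -(evX iota y) Lev.
Qed.

Lemma y_neq0 : y != 0. Proof. exact: transcendental_neq0 y_transcendental. Qed.

(** One of y and 1 / y is regular at P, so the local results stated for Y reach every place. *)
Lemma place_cases (P : place iota) :
  exists2 Y, transcendental iota Y /\ gen2 iota Y x & Y \in vring P.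
Proof.
have [yO|yO] := orP (vring_total P y).
  by exists y => //; split; [exact: y_transcendental | exact: curve_gen2].
exists y^-1 => //; split; first exact/transcendentalV/y_transcendental.
exact/gen2V/curve_gen2/y_neq0.
Qed.

Lemma curve_discrete (P : place iota) : exists t, uniformizer P t.
Proof. by have [Y [trY gY] YO] := place_cases P; exact: (place_discrete trY gY YO). Qed.

Lemma curve_residue_fin (P : place iota) :
  exists n, has_dim iota [set` vring P] [set` videal P] n.
Proof. by have [Y [trY gY] YO] := place_cases P; exact: (residue_has_dim trY gY YO). Qed.

Let discrete := curve_discrete.

(** Apply [place_exists] over K[z]: by transcendence z q(z) = 1 would be an identity of polynomials,
    and it fails at the constant term. *)
Lemma exists_zero (z : F) : transcendental iota z ->
  exists P : place iota, z \in videal P.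
Proof.
move=> trz; pose S : set F := [set w | exists p, w = ev z p].
have sS : is_subring S.
  split; first by exists 1; rewrite ev1.
    by move=> _ _ [p ->] [q ->]; exists (p - q); rewrite evB.
  by move=> _ _ [p ->] [q ->]; exists (p * q); rewrite evM.
have [||q Sq|P _ zP] := @place_exists _ _ iota S z sS; last by exists P.
- by move=> k; exists k%:P; rewrite evC.
- exact: transcendental_neq0 trz.
- have [p ->] : S q.[z].
    rewrite horner_coef; apply: is_subring_sum => // i.
    case: (sS) => _ _ SM; apply: SM => //; apply: is_subringX => //.
    by exists 'X; rewrite evX.
  rewrite -{1}(evX iota z) -evM => /eqP; rewrite -subr_eq0 -(ev1 iota z) -evB.
  rewrite ev_eq0 // subr_eq0 => /eqP/(congr1 (fun t : {poly K} => t`_0)).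
  by rewrite coefXM coef1 => /eqP; rewrite eq_sym oner_eq0.
Qed.

(** A pole of one of x and c / x would be a zero of the other, hence a pole of their sum A(y). *)
Lemma x_unit_finite (P : place iota) : y \in vring P -> x \in vunit P.
Proof.
move=> yO; have aO : ev y A \in vring P by apply: ev_vring.
apply/vunitP; split; first exact: x_neq0.
  apply: contraT => xO; have xV : x^-1 \in videal P by rewrite videalE invrK xO orbT.
  have : ev y A - iota c * x^-1 \in vring P.
    by rewrite rpredB // rpredM ?vring_const // videal_vring.
  by rewrite -curve_eq addrK (negPf xO).
apply: contraT => xV; have xP : x \in videal P by rewrite videalE xV orbT.
have : iota c^-1 * (ev y A - x) \in vring P.
  by rewrite rpredM ?vring_const // rpredB // videal_vring.
by rewrite -curve_eq addrC addKr fmorphV mulKf ?fmorph_eq0 // (negPf xV).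
Qed.

(** * Orders at the poles of y *)

Lemma pole_val (P : place iota) : y \notin vring P -> val P y < 0.
Proof. by rewrite (vring_valuation discrete) ?y_neq0 // -ltNge. Qed.

Lemma vge_ev (P : place iota) (p : {poly K}) k : y \notin vring P ->
  (size p <= k.+1)%N -> vge P (val P y *+ k) (ev y p).
Proof.
move=> /pole_val vy szp; rewrite evE; apply: (vge_sum discrete) => i _.
rewrite -[_ *+ k]add0r; apply: (vgeM discrete); first exact: vge_const.
right; rewrite valuationX // ler_nMn2l //.
by rewrite -ltnS (leq_trans (ltn_ord i)).
Qed.

Lemma val_ev (P : place iota) (p : {poly K}) : y \notin vring P -> p != 0 ->
  val P (ev y p) = val P y *+ (size p).-1.
Proof.
move=> yO p0; have vy := pole_val yO.
have szp : size p = (size p).-1.+1 by rewrite prednK // size_poly_gt0.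
set d := (size p).-1 in szp *.
have lead0 : iota p`_d != 0 by rewrite fmorph_eq0 lead_coef_eq0.
have yd0 : y ^+ d != 0 by rewrite expf_neq0 // y_neq0.
have vlead : val P (iota p`_d * y ^+ d) = val P y *+ d.
  by rewrite valuationM // valuation_const // valuationX // add0r.
rewrite evE szp big_ord_recr /= addrC -vlead.
have [||_ //] := @valuationD_lt _ _ _ discrete P (iota p`_d * y ^+ d)
  (\sum_(i < d) iota p`_i * y ^+ i); first exact: mulf_neq0.
rewrite vlead; apply: (vge_sum discrete) => i _.
rewrite -[_ + 1]add0r; apply: (vgeM discrete); first exact: vge_const.
right; rewrite valuationX //; apply: (@le_trans _ _ (val P y *+ i.+1 + 1)).
  by rewrite lerD2r ler_nMn2l.
by rewrite mulrSr; move: vy; clear; lia.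
Qed.

(** The sum A(y) of x and c / x has order m v(y) < 0, while their orders are opposite; so the
    negative one is m v(y). *)
Lemma pole_val_x (P : place iota) : y \notin vring P ->
  val P x = val P y *+ m \/ val P x = - (val P y *+ m).
Proof.
move=> yO; have vy := pole_val yO.
have A0 : A != 0 by rewrite -size_poly_gt0 szA.
have := val_ev yO A0; rewrite szA /= -curve_eq.
have cx0 : iota c / x != 0 by rewrite mulf_neq0 ?fmorph_eq0 // invr_eq0 x_neq0.
have vcx : val P (iota c / x) = - val P x.
  by rewrite valuationM ?fmorph_eq0 ?invr_eq0 ?x_neq0 // valuationV // valuation_const // add0r.
have vym : val P y *+ m < 0 by rewrite pmulrn_llt0.
case: (ltgtP (val P x) 0) => vx.
- have [||_ ->] := @valuationD_lt _ _ _ discrete P x (iota c / x).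
  + exact: x_neq0.
  + by right; rewrite vcx; move: vx; clear; lia.
  + by left.
- rewrite addrC; have [||_ ->] := @valuationD_lt _ _ _ discrete P (iota c / x) x => //.
  + by right; rewrite vcx; move: vx; clear; lia.
  + by rewrite vcx => <-; right; rewrite opprK.
- move=> e; have : vge P 0 (x + iota c / x).
    by apply: (vgeD discrete); right; rewrite ?vcx vx.
  case=> [h|]; last by rewrite e leNgt vym.
  by move: e; rewrite h valuation0 // => e; move: vym; rewrite -e.
Qed.

Lemma exists_pole0 : exists P : place iota,
  y \notin vring P /\ val P x = - (val P y *+ m).
Proof.
have [P xP] := exists_zero trx; exists P.
have yO : y \notin vring P.
  by apply/negP => /x_unit_finite; apply/negP/videalNunit.
split=> //; case: (pole_val_x yO) => // vx; have vy := pole_val yO.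
move: xP; rewrite (videal_valuation discrete) ?x_neq0 // vx.
by rewrite ltNge ltW // pmulrn_llt0.
Qed.

Lemma exists_pole1 : exists P : place iota,
  y \notin vring P /\ val P x = val P y *+ m.
Proof.
have [P xP] := exists_zero (transcendentalV trx); exists P.
have yO : y \notin vring P.
  by apply/negP => /x_unit_finite/vunitV; apply/negP/videalNunit.
split=> //; case: (pole_val_x yO) => // vx; have vy := pole_val yO.
move: xP; rewrite (videal_valuation discrete) ?invr_eq0 ?x_neq0 // valuationV // vx.
by rewrite opprK ltNge ltW // pmulrn_llt0.
Qed.

(** * Integral closedness of K[y] + K[y] x *)

Definition ev2 (r : {poly K} * {poly K}) : F := ev y r.1 + ev y r.2 * x.

Lemma ev2_qmul r s : ev2 (qmul A c r s) = ev2 r * ev2 s.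
Proof.
rewrite /ev2 /qmul /= !(evB, evD, evM) evC.
transitivity (ev y r.1 * ev y s.1 + (ev y r.1 * ev y s.2 + ev y r.2 * ev y s.1) * x
  + ev y r.2 * ev y s.2 * (x * x)); last by cring F.
by rewrite curve_sqr; cring F.
Qed.

Lemma ev2_qexp r n : ev2 (qexp A c r n) = ev2 r ^+ n.
Proof.
elim: n => [|n IHn]; first by rewrite /ev2 /= ev1 ev0 mul0r addr0.
by rewrite [LHS]ev2_qmul IHn exprS.
Qed.

Lemma val_ev2_pole (P : place iota) (b : {poly K}) : y \notin vring P -> b != 0 ->
  val P (ev y b * x) = val P y *+ (size b).-1 + val P x.
Proof.
move=> yO b0; rewrite valuationM ?x_neq0 ?ev_eq0 ?val_ev //.
exact: y_transcendental.
Qed.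

(** With b nonzero, a(y) = - b(y) x would force deg a = deg b - m at one pole of y and deg a = deg b
    + m at the other. *)
Lemma ev2_eq0 r : ev2 r = 0 -> r.1 = 0 /\ r.2 = 0.
Proof.
case: r => a b; rewrite /ev2 /=; have [->|b0] := eqVneq b 0.
  rewrite ev0 mul0r addr0 => /eqP; rewrite (ev_eq0 _ y_transcendental) => /eqP.
  by [].
move/eqP; rewrite addr_eq0 => /eqP e.
have a0 : a != 0.
  rewrite -(ev_eq0 _ y_transcendental) e oppr_eq0 mulf_neq0 ?x_neq0 //.
  by rewrite ev_eq0 //; apply: y_transcendental.
have [P0 [y0 vx0]] := exists_pole0; have [P1 [y1 vx1]] := exists_pole1.
have vN (P : place iota) := valuationN discrete P (ev y b * x).
have e0 : val P0 y *+ (size a).-1 + val P0 y *+ m = val P0 y *+ (size b).-1.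
  rewrite -val_ev // e vN val_ev2_pole // vx0 subrK.
  by [].
have e1 : val P1 y *+ (size a).-1 = val P1 y *+ ((size b).-1 + m).
  by rewrite -val_ev // e vN val_ev2_pole // vx1 mulrnDr.
have inj (P : place iota) i j : y \notin vring P -> val P y *+ i = val P y *+ j -> i = j.
  move=> /pole_val vy ij; apply/eqP; rewrite eqn_leq.
  by rewrite -!(ler_nMn2l vy) ij lexx.
move: e0; rewrite -mulrnDr => /(inj _ _ _ y0); move: e1 => /(inj _ _ _ y1).
by move: m_gt0; clear; lia.
Qed.

Lemma ev2_inj r s : ev2 r = ev2 s -> r = s.
Proof.
move=> e; have [] : r.1 - s.1 = 0 /\ r.2 - s.2 = 0.
  apply: (@ev2_eq0 (r.1 - s.1, r.2 - s.2)); rewrite /ev2 /= !evB.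
  transitivity (ev2 r - ev2 s); last by rewrite e subrr.
  by rewrite /ev2; cring F.
move=> /eqP; rewrite subr_eq0 => /eqP e1 /eqP; rewrite subr_eq0 => /eqP e2.
by rewrite (surjective_pairing r) e1 e2 -surjective_pairing.
Qed.

Let R : set F := [set z | exists r, z = ev2 r].

Lemma R_subring : is_subring R.
Proof.
split; first by exists (1, 0); rewrite /ev2 /= ev1 ev0 mul0r addr0.
  move=> _ _ [r ->] [s ->]; exists (r.1 - s.1, r.2 - s.2).
  by rewrite /ev2 /= !evB; cring F.
by move=> _ _ [r ->] [s ->]; exists (qmul A c r s); rewrite ev2_qmul.
Qed.

Lemma R_poly p : R (ev y p).
Proof. by exists (p, 0); rewrite /ev2 /= ev0 mul0r addr0. Qed.

(** A place over [R] at which f = p / r vanishes is wanted. If there is none, f q(f) = 1 with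
    coefficients in [R], so the powers of r / p have a common denominator p^k, and the trace and
    norm conditions make p divide both coordinates of r. *)
Lemma curve_normal_prime p r : irreducible_poly p ->
  ~~ ((p %| r.1) && (p %| r.2)) ->
  exists2 P : place iota, y \in vring P & ev2 r / ev y p \notin vring P.
Proof.
move=> irr ndiv; have p0 : ev y p != 0.
  by rewrite ev_eq0 ?irredp_neq0 //; apply: y_transcendental.
have r0 : ev2 r != 0.
  by apply: contraNneq ndiv => /ev2_eq0[-> ->]; rewrite dvdp0.
pose f := ev y p / ev2 r.
have f0 : f != 0 by rewrite mulf_neq0 ?invr_eq0.
have [||P RP fP] := @place_exists _ _ iota R f R_subring _ f0; last 1 first.
- exists P; first by apply: RP; rewrite -(evX iota y); apply: R_poly.
  by move: fP; rewrite videalE (negPf f0) /f invf_div.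
- by move=> k; rewrite -(evC iota y); apply: R_poly.
move=> q Rq fq; have sR := R_subring; have RM : forall a b, R a -> R b -> R (a * b).
  by case: sR.
have powR n : R (ev y p ^+ size q * f^-1 ^+ n).
  have [g [Rg szg ->]] := unit_ideal_powers n sR f0 Rq fq.
  rewrite (@horner_coef_wide _ (size q)) // mulr_sumr.
  apply: is_subring_sum => // i; rewrite mulrCA; apply: (RM) => //.
  have -> : ev y p ^+ size q * f^-1 ^+ i = ev y p ^+ (size q - i) * ev2 r ^+ i.
    rewrite /f invf_div expr_div_n mulrA mulrAC -{1}(subnK (ltnW (ltn_ord i))).
    by rewrite exprD mulfK ?expf_neq0.
  apply: (RM); last by apply: is_subringX => //; exists r.
  by apply: is_subringX => //; apply: R_poly.
have : forall n, exists s, p ^+ size q * (qexp A c r n).1 = p ^+ n * s.1 /\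
                       p ^+ size q * (qexp A c r n).2 = p ^+ n * s.2.
  move=> n; have [s sE] := powR n; exists s.
  suff [] : (p ^+ size q * (qexp A c r n).1, p ^+ size q * (qexp A c r n).2) =
     (p ^+ n * s.1, p ^+ n * s.2) by move=> -> ->.
  apply: ev2_inj; rewrite /ev2 /= !evM -!mulrA -!mulrDr -/(ev2 _) -/(ev2 _).
  rewrite -sE ev2_qexp !evXn mulrCA; congr (_ * _).
  by rewrite /f invf_div -exprMn mulrC divfK.
move=> /(qorder_norm_trace c0 irr ndiv)[ptr pn].
by case/negP: ndiv; exact: (qorder_smooth A' c0 irr ptr pn).
Qed.

(** Irreducible factors of the denominator are removed one by one; a factor that does not divide the
    numerator would leave a pole at a place where y is finite. *)
Lemma curve_normal z : (forall P : place iota, y \in vring P -> z \in vring P) ->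
  exists r, z = ev2 r.
Proof.
move=> zO; have [D [a [b [D0 e]]]] := curve_gen2 z.
have [n] := ubnP (size D); elim: n D a b D0 e => // n IHn D a b D0 e.
have evN0 p : p != 0 -> ev y p != 0 by rewrite ev_eq0 //; apply: y_transcendental.
have [szD _|szD] := leqP (size D) 1.
  have D00 : D`_0 != 0 by rewrite -polyC_eq0 -size1_polyC.
  exists ((D`_0)^-1 *: a, (D`_0)^-1 *: b); rewrite /ev2 /= !evZ -mulrA -mulrDr -e.
  rewrite {2}(size1_polyC szD) evC mulrA -rmorphM mulVf // rmorph1 mul1r.
  by [].
have [p irr pD] := irreducible_divisor szD; have [szp _] := irr.
have [D1 DE] := dvdpP _ _ pD; have p0 := irredp_neq0 irr.
have D10 : D1 != 0 by apply: contraNneq D0 => D10; rewrite DE D10 mul0r.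
have [/andP[/dvdpP[a1 aE] /dvdpP[b1 bE]]|ndiv] := boolP ((p %| a) && (p %| b)).
  rewrite ltnS => leDn; apply: (IHn D1 a1 b1) => //.
    apply: (mulIf (evN0 _ p0)); rewrite mulrAC -evM -DE e aE bE !evM.
    by cring F.
  apply: leq_trans leDn; rewrite DE size_mul //.
  by case: (size p) szp => [|[|k]] // _; rewrite !addnS ltnS leq_addr.
have [P yO /negP[]] := @curve_normal_prime p (a, b) irr ndiv.
rewrite /ev2 /= -e DE evM mulrAC mulfK ?evN0 //.
by rewrite rpredM ?zO // ev_vring.
Qed.

(** * The spaces L(n (y)_oo) *)

Implicit Types (P : place iota) (r : {poly K} * {poly K}) (p : {poly K}) (z : F).

Let residue_fin := curve_residue_fin.

Definition poles_y : place iota -> int := pole_divisor iota y.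

Lemma poles_y_fin (P : place iota) : y \in vring P -> poles_y P = 0.
Proof.
rewrite (vring_valuation discrete) ?y_neq0 // /poles_y /pole_divisor => vy.
by apply/max_idPl; rewrite oppr_le0.
Qed.

Lemma poles_y_inf (P : place iota) : y \notin vring P -> poles_y P = - val P y.
Proof.
move=> /pole_val vy; rewrite /poles_y /pole_divisor.
by apply/max_idPr; rewrite oppr_ge0 ltW.
Qed.

Lemma vge_x_pole (P : place iota) : y \notin vring P -> vge P (val P y *+ m) x.
Proof.
move=> yO; right; have vy := pole_val yO.
have : val P y *+ m < 0 by rewrite pmulrn_llt0.
by case: (pole_val_x yO) => ->; lia.
Qed.

Lemma vge_poles n (P : place iota) z : y \notin vring P ->
  vge P (- (n%:Z * poles_y P)) z <-> vge P (val P y *+ n) z.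
Proof. by move=> yO; rewrite poles_y_inf // mulrN opprK -natz mulr_natl. Qed.

Lemma ev2_mem n r : (size r.1 <= n.+1)%N -> (size r.2 <= n.+1 - m)%N ->
  rr setT (fun P => n%:Z * poles_y P) (ev2 r).
Proof.
move=> sz1 sz2 P _; have [yO|yO] := boolP (y \in vring P).
  rewrite poles_y_fin // mulr0 oppr0; apply/(vge_vring discrete).
  rewrite rpredD ?rpredM ?ev_vring //.
  by have /vunitP[] := x_unit_finite yO.
apply/vge_poles => //; apply: (vgeD discrete); first exact: vge_ev.
(* For n < m the truncated bound n + 1 - m is 0, which forces [r.2 = 0]. *)
have [lt|le] := ltnP n m.
  have -> : r.2 = 0 by apply/eqP; rewrite -size_poly_eq0; move: sz2 lt; clear; lia.
  by rewrite ev0 mul0r; left.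
rewrite -(subnK le) mulrnDr; apply: (vgeM discrete); last exact: vge_x_pole.
by apply: vge_ev => //; rewrite -subSn.
Qed.

(** In multiples of v(y), a(y) has order deg a at both poles, while b(y) x has deg b - m at [P0] and
    deg b + m at [P1]. Cancellation at [P1] requires deg a = deg b + m, and then a(y) dominates at
    [P0]. *)
Lemma ev2_mem_inv n z : rr setT (fun P => n%:Z * poles_y P) z ->
  exists r, [/\ z = ev2 r, size r.1 <= n.+1 & size r.2 <= n.+1 - m]%N.
Proof.
move=> zD; have [P yO|r zE] := curve_normal (z := z).
  apply/(vge_vring discrete); have := zD P I.
  by rewrite poles_y_fin // mulr0 oppr0.
have [P0 [y0 vx0]] := exists_pole0; have [P1 [y1 vx1]] := exists_pole1.
have z0 : vge P0 (val P0 y *+ n) (ev2 r) by rewrite -zE; apply/vge_poles/zD.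
have z1 : vge P1 (val P1 y *+ n) (ev2 r) by rewrite -zE; apply/vge_poles/zD.
have v0 := pole_val y0; have v1 := pole_val y1.
have evN0 p : p != 0 -> ev y p != 0 by rewrite (ev_eq0 _ y_transcendental).
have lt_vge (P : place iota) w k : y \notin vring P -> w != 0 ->
    val P w = val P y *+ k -> vge P (val P y *+ n) w -> (k <= n)%N.
  move=> /pole_val vy w0 vw [w00|]; first by rewrite w00 eqxx in w0.
  by rewrite vw ler_nMn2l.
have size_a (P : place iota) p : y \notin vring P ->
    vge P (val P y *+ n) (ev y p) -> (size p <= n.+1)%N.
  move=> yO; have [->|p0] := eqVneq p 0; first by rewrite size_poly0.
  move/(lt_vge _ _ _ yO (evN0 _ p0) (val_ev yO p0)).
  by rewrite -(prednK (_ : 0 < size p)%N) // size_poly_gt0.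
exists r; case: r {zD} zE z0 z1 => a b zE; rewrite /ev2 /= => z0 z1.
have [b0|b0] := eqVneq b 0.
  split=> //; last by rewrite b0 size_poly0.
  by apply: (size_a P0 a y0); move: z0; rewrite b0 ev0 mul0r addr0.
set sb := (size b).-1; have szb : size b = sb.+1.
  by rewrite /sb prednK // size_poly_gt0.
have vb0 : val P0 (ev y b * x) = val P0 y *+ sb - val P0 y *+ m.
  by rewrite val_ev2_pole // vx0.
have vb1 : val P1 (ev y b * x) = val P1 y *+ (sb + m).
  by rewrite val_ev2_pole // vx1 mulrnDr.
have bx0 : ev y b * x != 0 by rewrite mulf_neq0 ?x_neq0 ?evN0.
have le_sb : (sb + m <= n)%N.
  rewrite leqNgt; apply/negP => lt_n.
  have a0 : a != 0.
    apply/eqP => a0; move: z1; rewrite a0 ev0 add0r.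
    by move=> /(lt_vge _ _ _ y1 bx0 vb1); rewrite leqNgt lt_n.
  set sa := (size a).-1.
  have va (P : place iota) : y \notin vring P -> val P (ev y a) = val P y *+ sa.
    by move=> yO; rewrite val_ev.
  have lt_val (P : place iota) i j : y \notin vring P -> (i < j)%N ->
      val P y *+ j + 1 <= val P y *+ i.
    by move=> yO ij; rewrite lezD1 ltr_nMn2l // pole_val.
  case: (ltngtP sa (sb + m)) => cmp.
  - have [||s0 vs] := @valuationD_lt _ _ _ discrete P1 (ev y b * x) (ev y a) => //.
      by right; rewrite vb1 va // lt_val.
    move: z1; rewrite addrC => /(lt_vge _ _ _ y1 s0).
    by rewrite vs vb1 => /(_ _ erefl); rewrite leqNgt lt_n.
  - have [||s0 vs] := @valuationD_lt _ _ _ discrete P1 (ev y a) (ev y b * x).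
    + exact: evN0.
    + by right; rewrite vb1 va // lt_val.
    move: z1 => /(lt_vge _ _ _ y1 s0); rewrite vs va // => /(_ _ erefl).
    by rewrite leqNgt (ltn_trans lt_n).
  - have [||s0 vs] := @valuationD_lt _ _ _ discrete P0 (ev y a) (ev y b * x).
    + exact: evN0.
    + right; rewrite vb0 va // cmp lezD1 mulrnDr ltrD2l.
      have : val P0 y *+ m < 0 by rewrite pmulrn_llt0.
      by clear; lia.
    move: z0 => /(lt_vge _ _ _ y0 s0); rewrite vs va // => /(_ _ erefl).
    by rewrite cmp leqNgt lt_n.
split=> //; last by rewrite szb ltn_subRL addnC ltnS.
apply: (size_a P1 a y1); rewrite -(addrK (ev y b * x) (ev y a)).
apply: (vgeB discrete) => //; right; rewrite vb1 ler_nMn2l //.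
Qed.

Lemma rr_poles_dim n :
  has_dim iota (rr setT (fun P => n%:Z * poles_y P)) [set 0] (n.+1 + (n.+1 - m)).
Proof.
pose phi (v : 'rV[K]_(n.+1 + (n.+1 - m))) := ev2 (rVpoly (lsubmx v), rVpoly (rsubmx v)).
apply: (has_dim_rV (phi := phi)).
- move=> k u v; rewrite /phi /ev2 /= !linearP /= !evD !evZ; cring F.
- by move=> v; apply: ev2_mem; apply: size_poly.
- move=> v /ev2_eq0 /= [l0 r0]; rewrite -(hsubmxK v).
  by rewrite -[lsubmx v]rVpolyK -[rsubmx v]rVpolyK l0 r0 !linear0 row_mx0.
- move=> z /ev2_mem_inv[[a b] /= [-> sza szb]].
  exists (row_mx (poly_rV a) (poly_rV b)).
  by rewrite /phi row_mxKl row_mxKr !poly_rV_K //= subrr.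
Qed.

(** * Divisors of zeros and poles, and their degrees *)

Implicit Types (h : {poly K}) (d n k : nat) (s : seq (place iota)) (D : place iota -> int).

(** For nonzero h this is the full divisor of zeros of h(y), which has no zero at a pole of y. *)
Definition zeros_of h : place iota -> int :=
  fun P => if y \in vring P then val P (ev y h) else 0.

Lemma zeros_of_ge0 h P : h != 0 -> 0 <= zeros_of h P.
Proof.
move=> h0; rewrite /zeros_of; case: ifP => // yO.
rewrite -(vring_valuation discrete) ?ev_vring //.
by rewrite (ev_eq0 _ y_transcendental).
Qed.

Lemma poles_y_ge0 P : 0 <= poles_y P.
Proof. by rewrite /poles_y /pole_divisor le_max lexx. Qed.

Lemma poles_y_gt0 P : y \notin vring P -> 0 < poles_y P.
Proof. by move=> yO; rewrite poles_y_inf // oppr_gt0 pole_val. Qed.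

(** The principal divisor of h(y) is [zeros_of h] minus d times [poles_y], so multiplication by h(y)
    carries this space onto L((n + d) (y)_oo). *)
Lemma rr_shift h d n : h != 0 -> size h = d.+1 ->
  has_dim iota (rr setT (fun P => n%:Z * poles_y P + zeros_of h P)) [set 0]
    ((n + d).+1 + ((n + d).+1 - m)).
Proof.
move=> h0 szh.
have h0' : ev y h != 0 by rewrite (ev_eq0 _ y_transcendental).
have sub0 := @subspace0 K F iota.
apply: (has_dim_mul sub0 _ _ _ _ (rr_subspace discrete _ _)
  (rr_poles_dim (n + d)) (g := ev y h)).
- move=> z zC P _; have [yO|yO] := boolP (y \in vring P).
    have := zC P I; rewrite poles_y_fin // !mulr0 oppr0 /zeros_of yO add0r => hz.
    have vh : vge P (val P (ev y h)) (ev y h) by right.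
    by have := vgeM discrete vh hz; rewrite subrr.
  apply/vge_poles => //; have := zC P I; rewrite /zeros_of (negPf yO) addr0.
  move/(vge_poles _ _ yO) => hz; rewrite addnC mulrnDr; apply: (vgeM discrete) => //.
  by apply: vge_ev; rewrite ?szh.
- by move=> z /= ->; rewrite mulr0.
- by move=> z _ /= /eqP; rewrite mulf_eq0 (negPf h0') => /eqP.
- move=> z zD; exists ((ev y h)^-1 * z); last by rewrite /= mulrA divff // mul1r subrr.
  move=> P _; have vh : vge P (- val P (ev y h)) (ev y h)^-1.
    by right; rewrite valuationV.
  have := vgeM discrete vh (zD P I).
  have [yO|yO] := boolP (y \in vring P).
    by rewrite poles_y_fin // !mulr0 oppr0 addr0 /zeros_of yO add0r.
  rewrite val_ev // szh /= poles_y_inf // /zeros_of (negPf yO).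
  congr (vge P _ _); rewrite addr0 !mulrN !opprK PoszD mulrDl.
  by rewrite -[d%:Z]natz mulr_natl addrC addrK.
Qed.

Lemma polyX_neq0 : 'X != 0 :> {poly K}.
Proof. by rewrite polyX_eq0. Qed.

Lemma sum_degE s D : (forall P, P \in s -> 0 <= D P) ->
  \sum_(P <- s) D P * (place_deg P)%:Z =
  (\sum_(P <- s) `|D P| * place_deg P)%N%:Z.
Proof.
move=> D0; rewrite (big_morph Posz PoszD (erefl _)) big_seq [RHS]big_seq.
by apply: eq_bigr => P Ps; rewrite PoszM gez0_abs // D0.
Qed.

(** The poles of y are the zeros of 1 / y: the fundamental inequality is applied with Y = 1 / y and
    h = 'X. *)
Lemma poles_y_sum_le s : uniq s ->
  \sum_(P <- s) poles_y P * (place_deg P)%:Z <= 2.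
Proof.
move=> us; rewrite (bigID (fun P => y \in vring P)) /= big1 ?add0r => [|P yO]; last first.
  by rewrite poles_y_fin // mul0r.
rewrite -big_filter sum_degE => [|P _]; last exact: poles_y_ge0.
rewrite (lez_nat _ 1.*2).
apply: (zeros_degree_le discrete residue_fin (transcendentalV y_transcendental)
  (gen2V y_neq0 curve_gen2) polyX_neq0 (size_polyX _) (filter_uniq _ us)).
move=> P; rewrite mem_filter => /andP[yO _]; rewrite poles_y_ge0 poles_y_inf //.
rewrite (vring_valuation discrete) ?invr_eq0 ?y_neq0 // valuationV // evX.
rewrite oppr_ge0 ltW ?pole_val //; split=> //; right.
by rewrite valuationV.
Qed.

Lemma zeros_of_sum_le s h d : uniq s -> h != 0 -> size h = d.+1 ->
  \sum_(P <- s) zeros_of h P * (place_deg P)%:Z <= (d.*2)%:Z.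
Proof.
move=> us h0 szh.
rewrite (bigID (fun P => y \in vring P)) /= [X in _ + X]big1 ?addr0 => [|P yO]; last first.
  by rewrite /zeros_of (negPf yO) mul0r.
rewrite -big_filter sum_degE => [|P _]; last exact: zeros_of_ge0.
rewrite lez_nat.
apply: (zeros_degree_le discrete residue_fin y_transcendental curve_gen2 h0 szh
  (filter_uniq _ us)).
move=> P; rewrite mem_filter => /andP[yO _]; rewrite zeros_of_ge0 //; split=> //.
by rewrite /zeros_of yO; right.
Qed.

Lemma divisor_degE s D : uniq s -> (forall P, P \notin s -> D P = 0) ->
  divisor_deg D = \sum_(P <- s) D P * (place_deg P)%:Z.
Proof.
move=> us D0; rewrite /divisor_deg (fsbigE s) // => [|P _ Ps].
  by apply: eq_bigl => P; rewrite in_setT.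
by rewrite D0 // mul0r.
Qed.

Lemma divisor_supp D : divisor D ->
  exists2 s, uniq s & forall P, P \notin s -> D P = 0.
Proof.
move=> /finite_seqP[s sE]; exists (undup s); first exact: undup_uniq.
move=> P; rewrite mem_undup => Ps; apply/eqP; apply: contraNT Ps => DP.
have : [set P | D P != 0] P by [].
by rewrite sE.
Qed.

Lemma poles_y_divisor : divisor poles_y.
Proof.
apply: sub_finite_set (zeros_finite discrete residue_fin
  (transcendentalV y_transcendental) (gen2V y_neq0 curve_gen2) polyX_neq0).
move=> P /= PP; have yO : y \notin vring P.
  by apply: contraNN PP => yO; rewrite poles_y_fin.
have yV : y^-1 \in videal P by rewrite videalE invrK yO orbT.
by rewrite evX; split=> //; apply: videal_vring.
Qed.

Lemma zeros_of_divisor h : h != 0 -> divisor (zeros_of h).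
Proof.
move=> h0; apply: sub_finite_set (zeros_finite discrete residue_fin
  y_transcendental curve_gen2 h0).
move=> P /=; rewrite /zeros_of; case: ifP => // yO vh; split=> //.
have h0' : ev y h != 0 by rewrite (ev_eq0 _ y_transcendental).
rewrite (videal_valuation discrete) // lt_neqAle eq_sym vh /=.
by rewrite -(vring_valuation discrete) // ev_vring.
Qed.

Lemma rr_deg_mono s D D' k n : uniq s -> (forall P, D P <= D' P) ->
  (forall P, P \notin s -> D P = D' P) ->
  has_dim iota (rr setT D) [set 0] k -> has_dim iota (rr setT D') [set 0] n ->
  n%:Z - k%:Z <= \sum_(P <- s) (D' P - D P) * (place_deg P)%:Z.
Proof.
move=> us leD eqD hk hn.
have [l hl] := rr_dim_mono discrete residue_fin us leD eqD hn.
rewrite (has_dim_uniq (@subspace0 K F iota) hl hk) sum_degE.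
  by move=> le_n; rewrite lerBlDl -PoszD lez_nat.
by move=> P _; rewrite subr_ge0.
Qed.

Lemma divisor_add D D' : divisor D -> divisor D' ->
  divisor (fun P => D P + D' P).
Proof.
move=> dD dD'; have dU : finite_set ([set P | D P != 0] `|` [set P | D' P != 0]).
  by rewrite finite_setU.
apply: sub_finite_set dU => P /= DP.
have [D0|] := eqVneq (D P) 0; last by left.
by right; apply: contraNneq DP => D'0; rewrite D0 D'0.
Qed.

Lemma divisor_muln D n : divisor D -> divisor (fun P => n%:Z * D P).
Proof.
move=> dD; apply: sub_finite_set dD => P /=; apply: contraNN => /eqP->.
by rewrite mulr0.
Qed.

Lemma rr_poles_dim_m : has_dim iota (rr setT (fun P => m%:Z * poles_y P)) [set 0] m.+2.
Proof. by have := rr_poles_dim m; rewrite subSn // subnn addn1. Qed.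

(** Lower bound: from m (y)_oo to (m + 1) (y)_oo the dimension grows by 2, and it cannot grow by
    more than the degree. *)
Lemma poles_y_deg : divisor_deg poles_y = 2.
Proof.
have [s us s0] := divisor_supp poles_y_divisor.
rewrite (divisor_degE us s0); apply/eqP; rewrite eq_le poles_y_sum_le //=.
have := @rr_deg_mono s (fun P => m%:Z * poles_y P) (fun P => m.+1%:Z * poles_y P)
  _ _ us _ _ rr_poles_dim_m (rr_poles_dim m.+1).
have -> : (m.+2 + (m.+2 - m))%N%:Z - m.+2%:Z = 2 by clear; lia.
have -> : \sum_(P <- s) (m.+1%:Z * poles_y P - m%:Z * poles_y P) * (place_deg P)%:Z
    = \sum_(P <- s) poles_y P * (place_deg P)%:Z.
  by apply: eq_bigr => P _; rewrite -mulrBl intS addrK mul1r.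
apply=> [P|P Ps]; last by rewrite s0 // !mulr0.
by rewrite ler_wpM2r ?poles_y_ge0 // lez_nat leqnSn.
Qed.

Lemma zeros_y_deg : divisor_deg (zeros_of 'X) = 2.
Proof.
have X0 := polyX_neq0.
have [s us s0] := divisor_supp (zeros_of_divisor X0).
rewrite (divisor_degE us s0); apply/eqP; rewrite eq_le.
rewrite (zeros_of_sum_le us X0 (size_polyX _)) /=.
have := @rr_deg_mono s (fun P => m%:Z * poles_y P)
  (fun P => m%:Z * poles_y P + zeros_of 'X P)
  _ _ us _ _ rr_poles_dim_m (rr_shift m X0 (size_polyX _)).
have -> : ((m + 1).+1 + ((m + 1).+1 - m))%N%:Z - m.+2%:Z = 2 by clear; lia.
have -> : \sum_(P <- s) (m%:Z * poles_y P + zeros_of 'X P - m%:Z * poles_y P) *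
    (place_deg P)%:Z = \sum_(P <- s) zeros_of 'X P * (place_deg P)%:Z.
  by apply: eq_bigr => P _; rewrite [_ + zeros_of _ _]addrC addrK.
apply=> [P|P Ps]; last by rewrite s0 // addr0.
by rewrite lerDl zeros_of_ge0.
Qed.

(** At a place of the support where y is finite, a polynomial vanishing there is raised to the power
    |D P|; at the poles of y the multiple n absorbs D. *)
Lemma divisor_bound D : divisor D -> exists h, exists n,
  h != 0 /\ forall P, D P <= n%:Z * poles_y P + zeros_of h P.
Proof.
move=> dD; have [s us s0] := divisor_supp dD.
have /choice[g gP] : forall P, exists g : {poly K},
    y \in vring P -> g != 0 /\ ev y g \in videal P.
  move=> P; have [yO|_] := boolP (y \in vring P); last by exists 0.
  by have [g gP] := exists_zero_poly y_transcendental curve_gen2 yO; exists g.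
pose h := \prod_(P <- s | y \in vring P) g P ^+ `|D P|.
have h0 : h != 0.
  rewrite /h; elim/big_ind: _ => [|p q|P yO]; first exact: oner_neq0.
    exact: mulf_neq0.
  by rewrite expf_neq0 //; case: (gP P yO).
exists h, (\sum_(P <- s) `|D P|)%N; split=> // P.
have z0 := zeros_of_ge0 P h0.
have [Ps|Ps] := boolP (P \in s); last first.
  by rewrite s0 // addr_ge0 // mulr_ge0 // poles_y_ge0.
have leD : D P <= `|D P|%N%:Z by clear; lia.
apply: le_trans leD _.
have [yO|yO] := boolP (y \in vring P).
  rewrite poles_y_fin // mulr0 add0r /zeros_of yO.
  have [gP0 gPP] := gP P yO.
  pose h' := \prod_(Q <- rem P s | y \in vring Q) g Q ^+ `|D Q|.
  have hE : h = g P ^+ `|D P| * h' by rewrite /h (big_rem P) //= yO.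
  have evN0 p : p != 0 -> ev y p != 0 by rewrite (ev_eq0 _ y_transcendental).
  have h'0 : h' != 0 by apply: contraNneq h0 => h'0; rewrite hE h'0 mulr0.
  rewrite hE evM evXn valuationM ?expf_neq0 ?evN0 // valuationX //.
  apply: (@le_trans _ _ (val P (ev y (g P)) *+ `|D P|)); last first.
    by rewrite lerDl -(vring_valuation discrete) ?evN0 // ev_vring.
  have vg : 1 <= val P (ev y (g P)).
    by rewrite -gtz0_ge1 -(videal_valuation discrete) ?evN0.
  by rewrite -[X in X <= _]natz lerMn2r vg orbT.
rewrite -[X in X <= _]addr0 lerD // -[X in X <= _]mulr1.
have := poles_y_gt0 yO; rewrite gtz0_ge1 => p1.
apply: ler_pM => //; rewrite lez_nat (big_rem P) //=; exact: leq_addr.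
Qed.

(** * Riemann's inequality and the genus *)

Lemma riemann_ineq D : divisor D ->
  divisor_deg D - (RR_dim D)%:Z + 1 <= m%:Z - 1.
Proof.
move=> dD; have [h [n0 [h0 leD0]]] := divisor_bound dD.
(* Adding m makes n + d + 1 - m a true subtraction: L(C) has dimension 2 (n + d) + 2 - m, while deg
   C <= 2 (n + d). Hence deg D - l(D) <= deg C - l(C) <= m - 2. *)
pose n := (n0 + m)%N; pose C P := n%:Z * poles_y P + zeros_of h P.
have leD P : D P <= C P.
  apply: le_trans (leD0 P) _; rewrite lerD2r ler_wpM2r ?poles_y_ge0 //.
  by rewrite lez_nat leq_addr.
pose d := (size h).-1; have szh : size h = d.+1.
  by rewrite /d prednK // size_poly_gt0.
have dC : divisor C.
  by apply: divisor_add; [exact/divisor_muln/poles_y_divisor | exact: zeros_of_divisor].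
have [s us s0] : exists2 s, uniq s & forall P, P \notin s -> D P = 0 /\ C P = 0.
  have [s1 us1 h1] := divisor_supp dD; have [s2 us2 h2] := divisor_supp dC.
  exists (undup (s1 ++ s2)); first exact: undup_uniq.
  by move=> P; rewrite mem_undup mem_cat negb_or => /andP[/h1 ? /h2].
have hC := rr_shift n h0 szh.
have [k hk _] := rr_dim_mono discrete residue_fin us leD
  (fun P Ps => etrans (s0 P Ps).1 (esym (s0 P Ps).2)) hC.
have := rr_deg_mono us leD (fun P Ps => etrans (s0 P Ps).1 (esym (s0 P Ps).2)) hk hC.
have -> : RR_dim D = k.
  rewrite /RR_dim RR_spaceE; apply: dim_modE hk; exact: subspace0.
rewrite (divisor_degE us (fun P Ps => (s0 P Ps).1)).
under eq_bigr do rewrite mulrBl /C mulrDl -mulrA.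
rewrite sumrB big_split /= -mulr_sumr.
have := poles_y_sum_le us; have := zeros_of_sum_le us h0 szh.
set Z := \sum_(P <- s) zeros_of h P * _; set V := \sum_(P <- s) poles_y P * _.
set W := \sum_(P <- s) D P * _ => leZ leV.
have leV' : n%:Z * V <= n%:Z * 2 by rewrite ler_wpM2l.
have lem : (m <= n)%N by rewrite leq_addl.
move: lem leZ leV'; clear; set a := n%:Z * V; lia.
Qed.

Lemma curve_genus : has_genus iota (m%:Z - 1).
Proof.
split; last exact: riemann_ineq.
exists (fun P => m%:Z * poles_y P); first exact/divisor_muln/poles_y_divisor.
have -> : RR_dim (fun P => m%:Z * poles_y P) = m.+2.
  rewrite /RR_dim RR_spaceE; apply: dim_modE rr_poles_dim_m; exact: subspace0.
have -> : divisor_deg (fun P => m%:Z * poles_y P) = m%:Z * 2.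
  have [s us s0] := divisor_supp poles_y_divisor.
  rewrite -poles_y_deg (divisor_degE us s0) (@divisor_degE s) //.
    by rewrite mulr_sumr; apply: eq_bigr => P _; rewrite mulrA.
  by move=> P Ps; rewrite s0 // mulr0.
by clear; lia.
Qed.

(** * A rational place and the constant field *)

Lemma pole_divisor_yV : pole_divisor iota y^-1 = zeros_of 'X.
Proof.
apply/funext => P; rewrite /pole_divisor valuationV // opprK /zeros_of evX.
have [yO|yO] := boolP (y \in vring P).
  apply/max_idPr; by rewrite -(vring_valuation discrete) ?y_neq0.
by apply/max_idPl; rewrite ltW // pole_val.
Qed.

(** Two distinct poles of y, told apart by the sign of the order of x, share a total degree of at
    most 2, so each contributes exactly 1. *)
Lemma rational_pole : exists Q : place iota, val Q y^-1 = 1 /\ place_deg Q = 1%N.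
Proof.
have [P0 [y0 vx0]] := exists_pole0; have [P1 [y1 vx1]] := exists_pole1.
have P01 : P1 != P0.
  apply: contraTneq (pole_val y0) => e; rewrite -leNgt.
  rewrite e vx0 in vx1; rewrite -(pmulrn_lge0 _ m_gt0).
  by move: vx1; clear; lia.
have := @poles_y_sum_le [:: P0; P1]; rewrite /= inE eq_sym P01 => /(_ isT).
rewrite !big_cons big_nil addr0 => le2; exists P0.
have := poles_y_gt0 y0; have := poles_y_gt0 y1.
have := place_deg_gt0 residue_fin P0; have := place_deg_gt0 residue_fin P1.
move: le2; rewrite valuationV // -poles_y_inf //.
move: (poles_y P0) (poles_y P1) (place_deg P0) (place_deg P1) => a b d e.
clear => H d0 e0 b0 a0.
have h1 : 1 <= b * e%:Z by rewrite -[X in X <= _]mulr1 ler_pM //; lia.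
have h2 : a * d%:Z <= 1 by lia.
have ha : a <= a * d%:Z by rewrite -[X in X <= _]mulr1 ler_pM //; lia.
have hd : d%:Z <= a * d%:Z by rewrite -[X in X <= _]mul1r ler_pM //; lia.
by split; lia.
Qed.

(** An equation for z with nonzero constant term would put a nonzero constant into the maximal
    ideal. *)
Lemma algebraic_videal (P : place iota) z :
  algebraicOver iota z -> z \in videal P -> z = 0.
Proof.
move=> [p p0 pz] zP; apply/eqP; apply: contraT => z0.
have [n] := ubnP (size p); elim: n p p0 pz => // n IHn p p0 /rootP pz; rewrite ltnS => szp.
have := divpX p; rewrite -/(ev z p) in pz; set q := p %/ 'X => pE.
have zO := videal_vring zP.
have [c00|c00] := eqVneq p`_0 0.
  rewrite c00 polyC0 addr0 in pE.
  have q0 : q != 0 by apply: contraNneq p0 => q0; rewrite pE q0 mul0r.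
  apply: (IHn q q0).
    rewrite rootE; apply/eqP/(mulIf z0); rewrite mul0r -[RHS]pz pE evM evX.
    by [].
  by apply: leq_trans szp; rewrite pE size_mulX.
have : iota p`_0 \in videal P.
  have : ev z p = ev z q * z + iota p`_0 by rewrite {1}pE evD evM evX evC.
  rewrite pz => /esym/eqP; rewrite addrC addr_eq0 => /eqP->.
  by rewrite videalN // videalMl // ev_vring.
by rewrite const_videal (negPf c00).
Qed.

(** At a place of degree 1, z is congruent to a constant; the difference is algebraic and lies in
    the maximal ideal, hence is zero. *)
Lemma curve_constants z : algebraicOver iota z -> exists a, z = iota a.
Proof.
move=> algz; have [Q [_ dQ]] := rational_pole.
have zO : z \in vring Q.
  apply: contraT => zO; have zV : z^-1 \in videal Q by rewrite videalE invrK zO orbT.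
  have /eqP := algebraic_videal (algebraic_inv algz) zV.
  by rewrite invr_eq0 => /eqP z0; rewrite z0 rpred0 in zO.
have := place_degP residue_fin Q; rewrite dQ => -[b [bO _ gb]].
(* The basis element b of the residue field need not be 1: comparing 1 = u b with z = v b gives the
   constant v / u. *)
have [k1] := gb 1 (rpred1 _); have [k2] := gb z zO.
rewrite !big_ord1 /=; set u := k1 _; set v := k2 _ => zv uv.
have u0 : u != 0.
  apply/eqP => u0; move: uv; rewrite u0 rmorph0 mul0r subr0 => /videalNunit.
  by rewrite vunit1.
exists (v / u); apply/eqP; rewrite -subr_eq0; apply/eqP.
apply: (@algebraic_videal Q).
  by apply: algebraic_sub => //; apply: algebraic_id.
have -> : z - iota (v / u) = (z - iota v * b ord0) - iota (v / u) * (1 - iota u * b ord0).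
  rewrite mulrBr mulr1 mulrA -rmorphM divfK //.
  by rewrite opprB addrA subrK.
by rewrite videalB // videalMl // vring_const.
Qed.

Lemma curve_function_field : function_field iota.
Proof.
split; last exact: curve_constants.
exists y; first exact: y_transcendental.
exists 2, (fun i => if i == ord0 then 1 else x) => z.
have [D [a [b [D0 e]]]] := curve_gen2 z.
exists (fun i => (if i == ord0 then ev y a else ev y b) / ev y D).
  move=> i L divL LK Ly.
  have [L1 LB LV] := divL.
  have sL : is_subring [set` L].
    split=> //= u v uL vL.
    rewrite -[v]invrK; apply: (LV) => //; rewrite -[v^-1]mul1r; exact: LV.
  have Lev p : [set` L] (ev y p).
    rewrite evE; apply: (@is_subring_sum _ [set` L] _ _ _ sL) => j.
    case: (sL) => _ _ LM; apply: LM; first exact: LK.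
    by apply: is_subringX => //; apply: Ly.
  by apply: LV; [case: ifP => _; exact: Lev | exact: Lev].
rewrite big_ord_recl big_ord1 /= mulr1 mulrAC -mulrDl -e mulrAC.
by rewrite divff ?mul1r // (ev_eq0 _ y_transcendental).
Qed.

Lemma curve_friendly : function_field iota /\
  exists Q : place iota, has_genus iota (m%:Z - 1) /\
    exists z1 : F, val Q z1 = 1 /\ divisor_deg (pole_divisor iota z1) = 2.
Proof.
split; first exact: curve_function_field.
have [Q [vQ _]] := rational_pole; exists Q; split; first exact: curve_genus.
by exists y^-1; split=> //; rewrite pole_divisor_yV zeros_y_deg.
Qed.

End Curve.

(** * The two function fields *)

Section TracePolynomial.
Variables (K F : fieldType) (iota : {rmorphism K -> F}) (p : nat).
Hypotheses (p_gt1 : (1 < p)%N) (charK : p%:R = 0 :> K).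

Definition tpoly (u : nat) : {poly K} := \sum_(i < u) 'X^(p ^ i).

Lemma ev_tpoly u y : ev iota y (tpoly u) = trace_poly p u y.
Proof. by rewrite ev_sum; apply: eq_bigr => i _; rewrite evXn evX. Qed.

Lemma deriv_tpoly u : (tpoly u.+1)^`() = 1.
Proof.
rewrite /tpoly linear_sum big_ord_recl /= expn0 derivX big1 ?addr0 // => i _.
rewrite derivXn /bump /= add1n [X in _ *+ X]expnS mulrnA -[_ *+ p]mulr_natr.
by rewrite -polyC_natr charK polyC0 mulr0 mul0rn.
Qed.

Lemma size_tpoly u : size (tpoly u.+1) = (p ^ u).+1.
Proof.
elim: u => [|u IHu].
  by rewrite /tpoly big_ord1 expn0 size_polyX.
rewrite /tpoly big_ord_recr /= -/(tpoly u.+1) addrC size_polyDl size_polyXn //.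
by rewrite IHu ltnS ltn_exp2l.
Qed.

End TracePolynomial.

Lemma adjoin_transform (K F : fieldType) (iota : {rmorphism K -> F}) (x x' y : F) :
  (forall L : {pred F}, divring_closed L -> (forall k, iota k \in L) ->
     x' \in L -> x \in L) ->
  adjoin iota [set x; y] = [set: F] -> adjoin iota [set x'; y] = [set: F].
Proof.
move=> xx' gen; apply/seteqP; split=> // z _ L divL LK Ls.
have : adjoin iota [set x; y] z by rewrite gen.
apply=> // w /= [->|->]; last by apply: Ls; right.
by apply: (xx' L) => //; apply: Ls; left.
Qed.

(* Translating the sum of all elements of K by 1 leaves it unchanged. *)
Lemma natr_card_finField (K : finFieldType) : #|K|%:R = 0 :> K.
Proof.
apply: (addrI (\sum_(x : K) x)); rewrite addr0 -sumr_const -big_split /=.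
by rewrite [RHS](reindex_inj (addIr 1)).
Qed.

(** Moving the constant b into the trace polynomial changes neither its derivative 1 nor its degree
    p^(u-1). *)
Lemma trace_curve_friendly (p e u : nat) (K : finFieldType) (F : fieldType)
  (iota : {rmorphism K -> F}) (x y : F) (b c : K) : prime p -> #|K| = (p ^ e)%N ->
  (0 < u)%N -> c != 0 -> transcendental iota x ->
  adjoin iota [set x; y] = [set: F] ->
  trace_poly p u y = x + iota c / x + iota b -> m_friendly (p ^ (u - 1)) iota.
Proof.
move=> p_pr cardK u_gt0 c0 trx gen trE; have p_gt1 := prime_gt1 p_pr.
have charK : p%:R = 0 :> K.
  have := natr_card_finField K; rewrite cardK natrX => /eqP.
  by rewrite expf_eq0 => /andP[_ /eqP].
case: u u_gt0 trE => // u _ trE; rewrite subn1 /=.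
apply: (@curve_friendly K F iota x y (tpoly K p u.+1 - b%:P) c (p ^ u)) => //.
- by rewrite derivB derivC subr0 deriv_tpoly.
- rewrite size_polyDl size_tpoly // size_polyN ltnS.
  by rewrite (leq_trans (size_polyC_leq1 _)) // expn_gt0 ltnW.
- by rewrite expn_gt0 ltnW.
- by rewrite evB evC ev_tpoly trE addrK.
Qed.

(** * Bringing both equations to the form x + c / x *)

Section Moebius.
Variable F : fieldType.
Add Ring F_ring : (ring_theory_of F).

Lemma partial_fractions_translate (x a1 a2 : F) : x != 0 ->
  (x + a1) * (x + a2) / x = x + a1 * a2 / x + (a1 + a2).
Proof.
move=> x0; apply: (mulIf x0); rewrite divfK // !mulrDl divfK //.
by cring F.
Qed.

(** As v / u = 1 + d / u and u / v = 1 - d / v, the right-hand side is k d / u - l d / v, the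
    partial fraction expansion of the left-hand side. *)
Lemma partial_fractions_moebius (u v d k l : F) : u != 0 -> v != 0 ->
  k != 0 -> v = u + d -> (k - l) * d = 1 ->
  (u + k * (d * d)) / (u * v) =
    k * (v / u) + k * l / (k * (v / u)) - (k + l).
Proof.
move=> u0 v0 k0 vE kl.
have -> : k * l / (k * (v / u)) = l * (u / v).
  by rewrite !invfM invrK mulrACA divff // mul1r [v^-1 * u]mulrC.
apply: (mulIf (mulf_neq0 u0 v0)); rewrite divfK ?mulf_neq0 //.
transitivity (k * v * v * (u^-1 * u) + l * u * u * (v^-1 * v) - (k + l) * u * v);
  last by cring F.
rewrite !mulVf // vE -[u in LHS]mulr1 -[in LHS]kl.
by cring F.
Qed.

End Moebius.

Theorem theorem4p3 (p e q u m : nat) (K : finFieldType) (a1 a2 a3 : K)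
  (F1 : fieldType) (iota1 : {rmorphism K -> F1}) (x1 y1 : F1)
  (F2 : fieldType) (iota2 : {rmorphism K -> F2}) (x2 y2 : F2)
  (p_prime : prime p) (e_gt0 : (0 < e)%N) (q_def : q = (p ^ e)%N)
  (cardK : #|K| = q) (u_ge1 : (1 <= u)%N) (m_def : m = (p ^ (u - 1))%N)
  (a12 : a1 != a2) (a13 : a1 != a3) (a23 : a2 != a3)
  (x1_tr : transcendental iota1 x1)
  (F1_gen : adjoin iota1 [set x1; y1] = [set: F1])
  (F1_eq : trace_poly p u y1 =
     (x1 - iota1 a1) * (x1 - iota1 a2) / (x1 - iota1 a3))
  (x2_tr : transcendental iota2 x2)
  (F2_gen : adjoin iota2 [set x2; y2] = [set: F2])
  (F2_eq : trace_poly p u y2 =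
     (x2 - iota2 a3) / ((x2 - iota2 a1) * (x2 - iota2 a2))) :
  m_friendly m iota1 /\ m_friendly m iota2.
Proof.
rewrite m_def; rewrite q_def in cardK.
split.
(* The translation moves the finite pole a3 to 0; then c = (a3 - a1) (a3 - a2) is nonzero because
   the points are distinct. *)
- pose x := x1 - iota1 a3.
  have x_tr : transcendental iota1 x.
    move=> algx; apply: x1_tr; rewrite -(subrK (iota1 a3) x1).
    by apply: algebraic_add => //; apply: algebraic_id.
  apply: (@trace_curve_friendly p e u _ _ _ x y1 ((a3 - a1) + (a3 - a2))
    ((a3 - a1) * (a3 - a2))) => //.
  + by rewrite mulf_neq0 // subr_eq0 eq_sym.
  + apply: adjoin_transform F1_gen => L [L1 LB _] LK xL.
    have -> : x1 = x - (iota1 0 - iota1 a3) by rewrite rmorph0 sub0r opprK subrK.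
    by rewrite LB // LB.
  + rewrite F1_eq rmorphM (rmorphD _ (a3 - a1)) -partial_fractions_translate.
      by rewrite !rmorphB /x !addrA !subrK.
    exact: transcendental_neq0 x_tr.
- have neq (a : K) : x2 - iota2 a != 0.
    apply: contra_not_neq x2_tr => /eqP; rewrite subr_eq0 => /eqP->.
    exact: algebraic_id.
  pose d := a1 - a2; have d0 : d != 0 by rewrite subr_eq0.
  (* k d and - l d are the residues of the right-hand side at a1 and a2; they are nonzero because a3
     differs from both. *)
  pose k := (a1 - a3) / (d * d); pose l := (a2 - a3) / (d * d).
  have dd0 : d * d != 0 by rewrite mulf_neq0.
  have k0 : k != 0 by rewrite mulf_neq0 ?invr_eq0 // subr_eq0.
  have l0 : l != 0 by rewrite mulf_neq0 ?invr_eq0 // subr_eq0.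
  have kl : (k - l) * d = 1.
    rewrite -mulrBl opprB addrA subrK -/d invfM mulrA divff // mul1r.
    by rewrite mulVf.
  pose x := iota2 k * ((x2 - iota2 a2) / (x2 - iota2 a1)).
  (* Inverse of the Moebius transformation, by which transcendence and generation pass from x2 to
     x. *)
  have x2E : x2 = iota2 (k * d) / (x - iota2 k) + iota2 a1.
    have -> : x - iota2 k = iota2 (k * d) / (x2 - iota2 a1).
      apply: (mulIf (neq a1)); rewrite mulrBl divfK // /x mulrA divfK //.
      rewrite -mulrBr rmorphM rmorphB opprB; congr (_ * _).
      by rewrite addrC addrA subrK.
    rewrite invf_div mulrC divfK ?subrK //.
    by rewrite fmorph_eq0 mulf_neq0.
  apply: (@trace_curve_friendly p e u _ _ _ x y2 (- (k + l)) (k * l)) => //.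
  + by rewrite mulf_neq0.
  + move=> algx; apply: x2_tr; rewrite x2E; apply: algebraic_add.
      apply: algebraic_div; first exact: algebraic_id.
      by apply: algebraic_sub => //; apply: algebraic_id.
    exact: algebraic_id.
  + apply: adjoin_transform F2_gen => L [L1 LB LV] LK xL.
    have L0 : 0 \in L by rewrite -(subrr 1) LB.
    rewrite x2E -[iota2 a1]opprK; apply: (LB); last by rewrite -sub0r LB.
    by apply: LV => //; apply: (LB).
  + rewrite F2_eq rmorphN rmorphM rmorphD /x.
    rewrite -(@partial_fractions_moebius _ _ _ (iota2 d)) ?fmorph_eq0 //.
    * congr (_ / _); rewrite -!rmorphM /k divfK // rmorphB addrA subrK.
      by [].
    * by rewrite /d rmorphB addrA subrK.
    * by rewrite -rmorphB -rmorphM kl rmorph1.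
Qed.
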